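(* Let $G$ be a finite group and let $T=F^*(G)$ be its generalized Fitting subgroup. Let $\epsilon>0$, assume that $\Pr^*(T,G)\ge\epsilon$, and set $s=|\pi(F(G))|$. Then: (1) the exponent of $G/F(G)$ is $\epsilon$-bounded; (2) the index $|G:F(G)|$ is $(s,\epsilon)$-bounded.
   Context: For subsets $X,Y$ of a finite group, $\Pr(X,Y)=\frac{|\{(x,y)\in X\times Y : xy=yx\}|}{|X||Y|}$. $\pi(X)$ denotes the set of primes dividing $|X|$, and $Syl_p(X)$ the set of Sylow $p$-subgroups of $X$. For subgroups $X,Y$ of a finite group $G$, $\Pr^*(X,Y)$ denotes the maximum real number $\epsilon$ such that for every pair of distinct primes $p\in\pi(X)$ and $q\in\pi(Y)$ there are $P\in Syl_p(X)$ and $Q\in Syl_q(Y)$ with $\Pr(P,Q)\ge\epsilon$; thus ''$\Pr^*(X,Y)\ge\epsilon$'' means that for every such pair of distinct primes there are such $P,Q$ with $\Pr(P,Q)\ge\epsilon$. $F(G)$ is the Fitting subgroup of $G$. The generalized Fitting subgroup $F^*(G)$ is the product of $F(G)$ and all subnormal quasisimple subgroups of $G$, where a group is quasisimple if it is perfect and its quotient by its centre is a nonabelian simple group. The exponent of a finite group is the least positive integer $e$ with $x^e=1$ for all elements $x$. ''$(a,b,\ldots)$-bounded'' means bounded above by a number depending only on the parameters $a,b,\ldots$. *)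

(* Defs.v *)
From HB Require Import structures.
From mathcomp Require Import all_boot all_order all_algebra all_fingroup.
From mathcomp Require Import all_solvable.
From mathcomp Require Import reals.

Set Implicit Arguments.
Unset Strict Implicit.
Unset Printing Implicit Defensive.

Import Order.TTheory GRing.Theory Num.Theory.

Definition commuting_pairs (gT : finGroupType) (X Y : {set gT}) :=
  [set u in setX X Y | (u.1 * u.2)%g == (u.2 * u.1)%g].

Definition commuting_prob (R : realType) (gT : finGroupType)
    (X Y : {set gT}) : R :=
  (#|commuting_pairs X Y|%:R / (#|X|%:R * #|Y|%:R))%R.

(* This is the relation Pr^*(X, Y) >= eps, rather than the number Pr^*(X, Y):
   when there is no pair of distinct primes p in pi(X) and q in pi(Y), every
   real eps qualifies and the maximum does not exist. *)
Definition PrStar_ge (R : realType) (gT : finGroupType)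
    (X Y : {group gT}) (eps : R) : Prop :=
  forall p q : nat, p \in \pi(X) -> q \in \pi(Y) -> p <> q ->
  exists P Q : {group gT},
    [/\ P \in ('Syl_p(X))%g, Q \in ('Syl_q(Y))%g
      & (eps <= commuting_prob R P Q)%R].

Definition quasisimple (gT : finGroupType) (K : {group gT}) : bool :=
  [&& (K^`(1) == K :> {set gT})%g, simple (K / 'Z(K))%g
    & ~~ abelian (K / 'Z(K))%g].

(* F(G) is normal in G and normalizes every component, and distinct components
   commute, so the subgroup generated by all these factors is their product. *)
Definition gen_Fitting (gT : finGroupType) (G : {group gT}) : {group gT} :=
  <<'F(G) :|: \bigcup_(K : {group gT} | subnormal K G && quasisimple K) K>>%G.

(* Main.v *)
Require Import Defs.
From mathcomp Require Import all_boot all_order all_algebra all_fingroup.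
From mathcomp Require Import all_solvable.
From mathcomp Require Import reals.
From mathcomp Require Import zify.

(**
Write T = F*(G) and pass to counting: |P||Q| <= N #{commuting pairs}, with N >= 1/eps.

For a prime q > 2N an element that does not centralize a q-group commutes with at most 1/q of its elements,
so a Sylow q-subgroup of T is centralized by a subgroup of bounded index in some Sylow r-subgroup for each
r <> q.  Hence it has boundedly many conjugates, and it is normal when q is large.
For the boundedly many remaining primes p, a subgroup of bounded index in a Sylow p-subgroup P of T consists of elements whose T-class has bounded p'-part, so that each of them lies in a
positive proportion of the conjugates of P.  Averaging, P is commensurable with a positive proportion of
its conjugates, hence with all its conjugates under a subgroup of bounded index in T, and the
Bergman-Lenstra theorem makes |P : O_p(T)| bounded.  This bounds |T : F(G)| without the classification of
finite simple groups.

Next, O_p(G) commutes with positive probability with a Sylow q-subgroup for each q <> p, which by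
coprime action bounds the p'-part of G / C_G(O_p(G)); thus a normal subgroup of bounded index acts on
O_p(G) as a p-group.  A normal subgroup that acts on each O_p(G) as a p-group and acts trivially on
T / F(G) is contained in F(G), since a normal subgroup of G that centralizes F(G) but is not contained in it
contains a component.  Intersecting one such subgroup for each p in pi(F(G)) bounds the index of F(G), and
the exponent bound does not depend on the number of these primes. *)

Set Implicit Arguments.
Unset Strict Implicit.
Unset Printing Implicit Defensive.

Local Open Scope group_scope.

(** * Counting and commuting probability *)

(** Indices with [2 * N * f i < B] supply at most half of [#|A| * B]; the others, each with
    [f i <= B], must supply the rest. *)
Lemma markov_card (I : finType) (A : {set I}) (f : I -> nat) (B N : nat) :
  0 < B -> (forall i, i \in A -> f i <= B) ->
  #|A| * B <= N * \sum_(i in A) f i ->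
  #|A| <= 2 * N * #|[set i in A | B <= 2 * N * f i]|.
Proof.
move=> B0 fB hN; set X := finset _.
have: 2 * N * (\sum_(i in A) f i) <= 2 * N * #|X| * B + #|A| * B.
  rewrite (big_setID X) mulnDr leq_add //=.
    rewrite -(mulnA _ #|X|) leq_mul // -sum_nat_const.
    have -> : A :&: X = X by apply/setP=> i; rewrite !inE andbA andbb.
    by apply: leq_sum => i; rewrite inE => /andP[/fB].
  apply: (@leq_trans (#|A :\: X| * B)); last by rewrite leq_mul2r subset_leq_card ?subsetDl ?orbT.
  rewrite -sum_nat_const big_distrr; apply: leq_sum => i.
  by rewrite !inE => /andP[+ iA]; rewrite iA -ltnNge => /ltnW.
move=> h; have : 2 * (#|A| * B) <= 2 * N * #|X| * B + #|A| * B.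
  by apply: leq_trans h; rewrite -mulnA leq_mul2l hN orbT.
rewrite mul2n -addnn leq_add2r leq_pmul2r //.
Qed.

(** A prime dividing [n] is at most its part, hence at most [c]; this leaves the [c.+1] indices from
    0 to [c]. Later index bounds are proved one prime at a time this way. *)
Lemma leq_partn_bound (n c : nat) :
  0 < n -> (forall p, prime p -> n`_p <= c) -> n <= c ^ c.+1.
Proof.
move=> n0 hn.
have c0 : 0 < c by apply: leq_trans (hn 2 isT); rewrite part_gt0.
rewrite -{1}(partnT n0) (@widen_partn (n + c)) ?leq_addr //.
rewrite (big_cat_nat (n := c.+1)) //=; last by lia.
rewrite [X in (_ * X)%N]big1_seq ?muln1 //; last first.
  move=> p; rewrite mem_index_iota => /andP[_ /andP[cp _]].
  case pp: (prime p); last by rewrite lognE pp.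
  have := hn p pp; rewrite p_part; case: (logn p n) => // k.
  rewrite expnS; have := prime_gt0 pp; move=> p0.
  have : 0 < p ^ k by rewrite expn_gt0 p0.
  nia.
apply: (@leq_trans (\prod_(0 <= p < c.+1) c)).
  rewrite big_mkcond [X in _ <= X]big_mkcond; apply: leq_prod => p _ /=.
  case pp: (prime p); first by rewrite -p_part hn.
  by rewrite lognE pp.
by rewrite prod_nat_const_nat subn0.
Qed.

(** Commuting probability at least 1/[N] with denominators cleared; the sum counts commuting pairs
    by first coordinate. *)
Definition cfrac (gT : finGroupType) (N : nat) (X Y : {set gT}) :=
  #|X| * #|Y| <= N * \sum_(x in X) #|'C_Y[x]|.

Lemma sum_card_cent1 (gT : finGroupType) (X Y : {set gT}) :
  \sum_(x in X) #|'C_Y[x]| = \sum_(y in Y) #|'C_X[y]|.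
Proof.
under eq_bigr => x _ do rewrite -sum1_card.
under [RHS]eq_bigr => x _ do rewrite -sum1_card.
rewrite (exchange_big_dep (mem Y)) /=; last by move=> x y _; rewrite in_setI => /andP[].
apply: eq_bigr => y yY; apply: eq_bigl => x.
by rewrite !in_setI yY /= cent1C.
Qed.

Lemma card_commuting_pairs (gT : finGroupType) (X Y : {set gT}) :
  #|commuting_pairs X Y| = \sum_(x in X) #|'C_Y[x]|.
Proof.
rewrite -sum1_card.
under [RHS]eq_bigr => x _ do rewrite -sum1_card.
rewrite (pair_big_dep (mem X) (fun x => mem ('C_Y[x]))) /=.
apply: eq_bigl => -[x y] /=.
transitivity ((x \in X) && (y \in 'C_Y[x])) => //.
rewrite in_setI in_set in_setX cent1C -!andbA; congr [&& _, _ & _].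
by apply/eqP/cent1P.
Qed.

Lemma cfracC (gT : finGroupType) N (X Y : {set gT}) :
  cfrac N X Y -> cfrac N Y X.
Proof. by rewrite /cfrac mulnC sum_card_cent1. Qed.

(** The product of ['C_Y[x]] and [Z] lies in [Y], so the fraction of [Z] commuting with [x] is at
    least that of [Y]. *)
Lemma cfracS (gT : finGroupType) N (X : {set gT}) (Y Z : {group gT}) :
  Z \subset Y -> cfrac N X Y -> cfrac N X Z.
Proof.
rewrite /cfrac => ZY h.
have key : (\sum_(x in X) #|'C_Y[x]|) * #|Z| <= (\sum_(x in X) #|'C_Z[x]|) * #|Y|.
  rewrite !big_distrl; apply: leq_sum => x _ /=.
  have -> : 'C_Z[x] = 'C_Y[x] :&: Z by rewrite setIAC (setIidPr ZY).
  have := mul_cardG [group of 'C_Y[x]] Z; rewrite /= => ->.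
  by rewrite mulnC leq_mul2l subset_leq_card ?orbT // mul_subG ?subsetIl.
rewrite -(leq_pmul2r (cardG_gt0 Y)); move: key h.
move: (\sum_(x in X) _) (\sum_(x in X) _) => a b ab xN.
by rewrite mulnAC -[leqRHS]mulnA (leq_trans (leq_mul xN (leqnn _))) // -mulnA leq_mul.
Qed.

Lemma cfracJ (gT : finGroupType) N (X Y : {set gT}) g :
  cfrac N X Y -> cfrac N (X :^ g) (Y :^ g).
Proof.
rewrite /cfrac !cardJg => h; apply: leq_trans h _; rewrite leq_mul2l.
apply/orP; right; rewrite big_imset /=; last by move=> ? ? _ _; apply: conjg_inj.
apply: eq_leq; apply: eq_bigr => x _.
by rewrite -(cardJg _ g) conjIg -cent1J.
Qed.

(* Think of log d as a length function.  Along a sequence of rapidly growing radii each strict growth of the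
   ball adds a disjoint translate of the ball {d <= m}, which has density at least 1/D; so
   some ball S satisfies S * S = S. *)
Lemma weight_subgroup (m D : nat) : exists M : nat,
  forall (gT : finGroupType) (T : {group gT}) (d : gT -> nat),
    {in T &, forall x y, d (x * y)%g <= d x * d y} ->
    {in T, forall x, d x^-1%g = d x} ->
    0 < m -> d 1%g <= m ->
    #|T| <= D * #|[set x in T | d x <= m]| ->
  exists H : {group gT},
    [/\ H \subset T, #|T : H| <= D, [set x in T | d x <= m] \subset H
      & {in H, forall x, d x <= M}].
Proof.
(* If [x] has weight above [c i * m] but at most its square, then the translate by [x] of the ball
   of radius [m] misses the ball of radius [c i] and stays inside that of radius [c i.+1]. *)
pose c i := iter i (fun c => ((c * m) ^ 2 * m)%N) m.
exists (c D * m)%N => gT T d dM dV m0 d1 hD.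
pose S n := [set x in T | d x <= n].
have T0 := cardG_gt0 T.
have D0 : 0 < D by case: (D) hD => //; lia.
have cS i : c i.+1 = ((c i * m) ^ 2 * m)%N by [].
have up a : a <= ((a * m) ^ 2 * m)%N.
  by case: a => // a; rewrite -mulnn -!mulnA leq_pmulr // !muln_gt0 m0.
have cm i : m <= c i by elim: i => // i IH; apply: leq_trans IH (up _).
have cc : {homo c : i j / i <= j}.
  apply: homo_leq => [//|? ? ?|i]; first exact: leq_trans.
  exact: up.
have SS a b : a <= b -> S a \subset S b.
  by move=> ab; apply/subsetP=> x; rewrite !inE => /andP[-> /leq_trans->].
have [i iD hi] : exists2 i, i < D & S ((c i * m) ^ 2)%N \subset S (c i * m)%N.
  case: (pickP (fun i : 'I_D => S ((c i * m) ^ 2)%N \subset S (c i * m)%N)) => [i hi|no].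
    by exists i.
  (* Without a stable radius, the ball of radius [c D] would have [D.+1] times the size of [S m],
     more than [#|T|] allows. *)
  suff grow j : j <= D -> j.+1 * #|S m| <= #|S (c j)|.
    have := grow D (leqnn D); have : #|S (c D)| <= #|T|.
      by rewrite subset_leq_card //; apply/subsetP=> x; rewrite inE => /andP[].
    have : 0 < #|S m| by apply/card_gt0P; exists 1; rewrite inE group1 d1.
    rewrite -/(S m) in hD; nia.
  elim: j => [|j IH] jD; first by rewrite mul1n.
  have /subsetPn[x] := negbT (no (Ordinal jD)).
  rewrite !inE => /andP[xT dx]; rewrite xT /= -ltnNge => dx'.
  rewrite mulSn; apply: leq_trans (leq_add (leqnn _) (IH (ltnW jD))) _.
  rewrite -(card_lcoset (S m) x) -cardsUI (_ : _ :&: _ = set0) ?cards0 ?addn0.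
    apply: subset_leq_card; rewrite subUset SS ?andbT; last exact: up.
    apply/subsetP=> _ /lcosetP[s /[!inE] /andP[sT ds] ->].
    rewrite groupM //=; apply: leq_trans (dM _ _ xT sT) _.
    by rewrite leq_mul.
  apply/setP=> y; rewrite !inE; apply/negbTE/negP => /and3P[/lcosetP[s]].
  rewrite inE => /andP[sT ds] -> _ dxs.
  have := dM (x * s) s^-1 (groupM xT sT) (groupVr sT); rewrite mulgK dV //.
  by move=> /leq_trans/(_ (leq_mul dxs ds)); rewrite leqNgt dx'.
have gS : group_set (S (c i * m)%N).
  apply/group_setP; split=> [|x y].
    by rewrite inE group1 /=; apply: leq_trans d1 _; move: (cm i); nia.
  rewrite inE => /andP[xT dx]; rewrite inE => /andP[yT dy].
  apply: (subsetP hi); rewrite inE groupM //=.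
  by apply: leq_trans (dM _ _ xT yT) _; rewrite -mulnn leq_mul.
have sHT : Group gS \subset T by apply/subsetP=> x; rewrite inE => /andP[].
exists (Group gS); split=> //=.
- rewrite -(leq_pmul2l (cardG_gt0 (Group gS))) Lagrange // mulnC.
  apply: leq_trans hD _.
  by rewrite leq_mul2l subset_leq_card ?orbT // SS // (leq_trans (cm i)) ?leq_pmulr.
- by apply: SS; rewrite (leq_trans (cm i)) ?leq_pmulr.
- move=> x; rewrite inE => /andP[_ dx]; apply: leq_trans dx _.
  by rewrite leq_mul // cc // ltnW.
Qed.

(** * Subgroups with uniformly commensurable conjugates *)

Lemma leq_indexSg (gT : finGroupType) (G K : {set gT}) (H : {set gT}) :
  G \subset K -> #|G : H| <= #|K : H|.
Proof. by move=> sGK; apply: subset_leq_card; apply: imsetS. Qed.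

Lemma leq_indexgS (gT : finGroupType) (G H K : {group gT}) :
  H \subset K -> #|G : K| <= #|G : H|.
Proof. by move=> sHK; rewrite dvdn_leq ?indexg_gt0 ?indexgS. Qed.

Lemma leq_indexI (gT : finGroupType) (G H K : {group gT}) :
  #|G : H :&: K| <= #|G : H| * #|G : K|.
Proof.
have -> : #|G : H :&: K| = (#|G : H| * #|G :&: H : K|)%N.
  rewrite -(indexgI G (H :&: K)%G) -(indexgI G H) -(indexgI (G :&: H)%G K) /= setIA.
  by rewrite Lagrange_index ?subsetIl.
by rewrite leq_mul2l leq_indexSg ?orbT ?subsetIl.
Qed.

Lemma index_astab_leq (aT : finGroupType) (rT : finType) (D : {group aT})
    (to : action D rT) (G : {group aT}) (S : {set rT}) :
  [acts G, on S | to] -> #|G : 'C_G(S | to)| <= #|S|`!.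
Proof.
move=> GS; pose nGS := (GS : actby_cond G S to).
pose f := actperm <[nGS]>.
have kerf : 'ker f = 'C_G(S | to) by rewrite ker_actperm astab_actby setIT.
have := card_morphim [morphism of f] G.
rewrite setIid /= kerf => <-; rewrite -(card_perm S) subset_leq_card //.
apply/subsetP=> _ /morphimP[a _ aG ->]; apply/subsetP=> x.
rewrite inE; apply: contraR => xS.
by rewrite actpermE /= /actby (negPf xS).
Qed.

Lemma index_gcore_leq (gT : finGroupType) (G H : {group gT}) :
  #|G : gcore H G| <= #|G : H|`!.
Proof.
have := index_astab_leq (actsRs_rcosets H G).
by rewrite astabRs_rcosets indexgI.
Qed.

Lemma index_cent_leq (gT : finGroupType) (G A : {group gT}) :
  G \subset 'N(A) -> #|G : 'C_G(A)| <= #|A|`!.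
Proof.
move=> nAG; have GA : [acts G, on A | 'J] by rewrite astabsJ.
by have := index_astab_leq GA; rewrite astabJ.
Qed.

(** [A] is a mere set of conjugating elements, whose size bounds the number of conjugates; the empty
    set gives the whole group type. *)
Definition conj_cap (gT : finGroupType) (P : {group gT}) (A : {set gT}) :=
  \bigcap_(a in A) P :^ a.

Canonical conj_cap_group (gT : finGroupType) (P : {group gT}) (A : {set gT}) :=
  [group of conj_cap P A].

Section ConjCap.

Variables (gT : finGroupType) (P H : {group gT}) (M : nat).
Hypothesis (PM : {in H, forall h, #|P : P :^ h| <= M}).

Lemma conj_cap_sub (A : {set gT}) a : a \in A -> conj_cap P A \subset P :^ a.
Proof. by move=> aA; apply: bigcap_inf. Qed.

Lemma conj_capJ (A : {set gT}) h : conj_cap P A :^ h = conj_cap P (A :* h).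
Proof.
apply/setP=> x; rewrite mem_conjg; apply/bigcapP/bigcapP => hx a.
  by case/rcosetP=> b bA ->; rewrite conjsgM mem_conjg hx.
by move=> aA; rewrite -mem_conjg -conjsgM hx // mem_rcoset mulgK.
Qed.

Lemma conj_capM (A B : {set gT}) b : b \in B -> conj_cap P (A * B) \subset conj_cap P A :^ b.
Proof.
move=> bB; rewrite conj_capJ; apply/subsetP=> x /bigcapP hx.
by apply/bigcapP=> _ /rcosetP[a aA ->]; apply: hx; apply: mem_mulg.
Qed.

(** Each further conjugate costs a factor [M], since any two conjugates under [H] meet in index at
    most [M]. *)
Lemma leq_card_conj_cap (A : {set gT}) r :
  A \subset H -> 0 < #|A| <= r -> #|P| <= M ^ r * #|conj_cap P A|.
Proof.
move=> sAH /andP[/card_gt0P[a0 a0A] Ar].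
have M0 : 0 < M by apply: leq_trans (PM (group1 H)); apply: indexg_gt0.
have main (B : {set gT}) : B \subset H ->
    #|P| <= M ^ #|B| * #|P :^ a0 :&: conj_cap P B|.
  have [n] := ubnP #|B|; elim: n B => // n IH B.
  have [->|[b bB]] := set_0Vmem B.
    by rewrite /conj_cap big_set0 setIT cards0 expn0 mul1n cardJg.
  rewrite ltnS (cardsD1 b) bB => ltn sBH.
  have bH : b \in H by apply: (subsetP sBH).
  apply: leq_trans (IH _ ltn (subset_trans (subsetDl _ _) sBH)) _.
  rewrite add1n expnS [leqRHS]mulnC mulnA [leqRHS]mulnC leq_mul2l.
  apply/orP; right.
  set X := P :^ a0 :&: conj_cap P (B :\ b).
  have -> : P :^ a0 :&: conj_cap P B = X :&: P :^ b.
    rewrite -setIA; congr (_ :&: _); rewrite /conj_cap (bigD1 b) //= setIC.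
    by congr (_ :&: _); apply: eq_bigl => i; rewrite !inE andbC.
  have -> : #|X| = (#|X :&: P :^ b| * #|X : P :^ b|)%N.
    by rewrite -(LagrangeI [group of X] (P :^ b)).
  rewrite leq_mul2l; apply/orP; right.
  apply: (@leq_trans #|P :^ a0 : P :^ b|); first by rewrite leq_indexSg ?subsetIl.
  rewrite -[b](mulgKV a0) conjsgM indexJg PM // groupM ?groupV //.
  exact: (subsetP sAH).
have := main A sAH; rewrite (setIidPr (conj_cap_sub a0A)) => /leq_trans; apply.
by rewrite leq_mul2r leq_pexp2l ?orbT.
Qed.

End ConjCap.

Lemma pcoreS_normal (gT : finGroupType) (p : nat) (N G : {group gT}) :
  N <| G -> 'O_p(N) \subset 'O_p(G).
Proof. by move=> nNG; rewrite pcore_max ?pcore_pgroup ?gFnormal_trans. Qed.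

Lemma lstab_group_set (gT : finGroupType) (Y : {set gT}) :
  group_set [set g : gT | g *: Y == Y].
Proof.
apply/group_setP; split=> [|x y]; first by rewrite inE lcoset1.
by rewrite !inE => /eqP xY /eqP yY; rewrite lcosetM yY xY.
Qed.

(** Induction on [n], which bounds the index in U = [conj_cap P A] of its intersections with
    conjugates of [P]. Either some intersection of at most [r * K] conjugates improves the bound, or
    none does, and then the conjugates of U generate a small normal subgroup. *)
Lemma bergman_lenstra_step (M n : nat) : forall r : nat, exists C : nat,
  forall (gT : finGroupType) (H P : {group gT}) (p : nat) (A : {set gT}),
    p.-group P -> P \subset H -> {in H, forall h, #|P : P :^ h| <= M} ->
    A \subset H -> 0 < #|A| <= r ->
    {in H, forall h, #|conj_cap P A : P :^ h| <= n} ->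
  #|P| <= C * #|'O_p(H)|.
Proof.
elim: n => [|n IHn] r.
  exists 0%N => gT H P p A _ _ _ _ _ /(_ 1 (group1 H)).
  by rewrite leqNgt indexg_gt0.
(* After [K.-1] doublings, [#|U|] would exceed [n.+1 * #|P|], the bound on [N B]. *)
pose K := (n.+1 * M ^ r).+1; have [C0 hC0] := IHn (r * K)%N.
exists (maxn C0 (M ^ r * (n.+1 * M ^ r)`!)) => gT H P p A pP sPH PM sAH Ar Un.
have leU := leq_card_conj_cap PM sAH Ar.
pose good (B : {set gT}) := [&& B \subset H, 0 < #|B| <= r * K
  & [forall (h | h \in H), #|conj_cap P B : P :^ h| <= n]].
have [/existsP[B /and3P[sBH Br /forall_inP Bn]] | nogood] := boolP [exists B, good B].
  apply: leq_trans (hC0 gT H P p B pP sPH PM sBH Br Bn) _.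
  by rewrite leq_mul2r leq_maxl orbT.
set U := conj_cap P A in leU Un.
have cardU : 0 < #|U| by apply: cardG_gt0 [group of U].
pose N (B : {set gT}) := <<\bigcup_(b in B) U :^ b>>.
(* Any K conjugates of U generate a subgroup of order at most (n + 1)|P|: with D their
   intersection and h such that |D : P ^ h| > n, each of them stabilizes D * P ^ h. *)
have smallN (B : {set gT}) : B \subset H -> 0 < #|B| <= K ->
    #|N B| <= n.+1 * #|P|.
  move=> sBH /andP[B0 BK].
  have sABH : A * B \subset H by rewrite mul_subG.
  have AB0 : 0 < #|A * B|.
    case/andP: Ar => /card_gt0P[a aA] _; case/card_gt0P: B0 => b bB.
    by apply/card_gt0P; exists (a * b); apply: mem_mulg.
  have ABr : #|A * B| <= r * K.
    apply: leq_trans (leq_mul (proj2 (andP Ar)) BK).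
    rewrite -cardsX; have -> : A * B = [set u.1 * u.2 | u in setX A B].
      apply/setP=> x; apply/mulsgP/imsetP => [[a b aA bB ->]|[[a b]]].
        by exists (a, b); rewrite ?in_setX ?aA.
      by rewrite in_setX => /andP[/= aA bB] ->; exists a b.
    exact: leq_imset_card.
  have /forall_inPn[h hH] : ~~ [forall (h | h \in H), #|conj_cap P (A * B) : P :^ h| <= n].
    move: nogood; rewrite negb_exists => /forallP/(_ (A * B)).
    by rewrite /good sABH AB0 ABr.
  rewrite -ltnNge => Dn; set D := conj_cap P (A * B) in Dn.
  pose Y := D * P :^ h.
  have YUb b : b \in B -> U :^ b * P :^ h = Y /\ #|Y| <= n.+1 * #|P|.
    move=> bB; have bH : b \in H by apply: (subsetP sBH).
    have sDU : D \subset U :^ b by apply: conj_capM.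
    have sY : Y \subset U :^ b * P :^ h by apply: mulSg.
    have leUP : #|U :^ b * P :^ h| <= n.+1 * #|P|.
      rewrite -(LagrangeMr [group of U :^ b] [group of P :^ h]) /= cardJg leq_mul2r.
      rewrite -[h](mulgKV b) conjsgM indexJg Un ?orbT // groupM ?groupV //.
    have leY : n.+1 * #|P| <= #|Y|.
      rewrite -(LagrangeMr [group of D] [group of P :^ h]) /= cardJg leq_mul2r Dn.
      by rewrite orbT.
    split; last by apply: leq_trans (subset_leq_card sY) leUP.
    by apply/eqP; rewrite eq_sym eqEcard sY (leq_trans leUP leY).
  pose L := Group (lstab_group_set Y).
  have sNL : N B \subset L.
    rewrite gen_subG; apply/bigcupsP=> b bB; apply/subsetP=> u uUb.
    have [defY _] := YUb b bB.
    rewrite inE -defY mulgA.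
    have -> : u *: (U :^ b) = U :^ b by apply: (@lcoset_id _ [group of U :^ b]).
    by [].
  case/card_gt0P: B0 => b bB; have [_] := YUb b bB; apply: leq_trans.
  apply: leq_trans (subset_leq_card sNL) _; apply: subset_leq_card.
  have Y1 : 1 \in Y by rewrite -[1]mulg1 mem_mulg ?(group1 [group of D]) ?group1.
  apply/subsetP=> g; rewrite inE => /eqP <-; rewrite -[X in X \in _](mulg1 g).
  by rewrite mem_lcoset mulKg.
have NS (B B' : {set gT}) : B \subset B' -> N B \subset N B'.
  move=> sBB; rewrite genS //; apply/bigcupsP=> b bB.
  by apply: bigcup_sup; apply: (subsetP sBB).
(* Greedy choice of [B]: adjoining an [h] with [U :^ h] outside [N B] at least doubles [N B], and
   [smallN] stops this in time. *)
have [B [sBH B0 allN]] : exists B : {set gT}, [/\ B \subset H, 0 < #|B| <= K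
    & {in H, forall h, U :^ h \subset N B}].
  suff main j : j < K -> exists B : {set gT}, [/\ B \subset H, 0 < #|B| <= j.+1
      & {in H, forall h, U :^ h \subset N B} \/ 2 ^ j * #|U| <= #|N B|].
    have [B [sBH B0 [allN | big]]] := main K.-1 (leqnn _); first by exists B.
    have := leq_trans big (smallN B sBH B0); rewrite leqNgt => /negP[].
    apply: leq_ltn_trans (leq_mul (leqnn n.+1) leU) _.
    by rewrite mulnA ltn_pmul2r // ltn_expl.
  elim: j => [_|j IHj jK].
    exists [set 1]; rewrite sub1set group1 cards1; split=> //; right.
    by rewrite expn0 mul1n subset_leq_card // /N big_set1 conjsg1 sub_gen.
  have [B [sBH /andP[B0 Bj] [allN | big]]] := IHj (ltnW jK).
    by exists B; rewrite B0 (leq_trans Bj) //; split=> //; left.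
  have [allN | /forall_inPn[h hH nUh]] := boolP [forall (h | h \in H), U :^ h \subset N B].
    exists B; rewrite B0 (leq_trans Bj) //; split=> //; left.
    exact/forall_inP.
  exists (h |: B); split.
  - by rewrite subUset sub1set hH.
  - rewrite cardsU1 -[j.+2]add1n leq_add ?leq_b1 // addn_gt0 B0 orbT //.
  right; have sN : N B \subset N (h |: B) by apply: NS; apply: subsetUr.
  have : 1 < #|N (h |: B) : N B|.
    rewrite indexg_gt1; apply: contra nUh => sN'; apply: subset_trans sN'.
    by rewrite sub_gen // (bigcup_max h) ?setU11.
  by move=> ind; rewrite -(Lagrange sN) expnS -mulnA mulnC leq_mul.
pose NB := [group of N B].
have sNH : NB \subset H.
  rewrite gen_subG; apply/bigcupsP=> b /(subsetP sBH) bH.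
  case/andP: Ar => /card_gt0P[a aA] _; have aH := subsetP sAH a aA.
  have /subset_trans-> // : U :^ b \subset (P :^ a) :^ b.
    by rewrite conjSg conj_cap_sub.
  by rewrite -conjsgM conj_subG // groupM.
have nN : NB <| H.
  rewrite /normal sNH; apply/normsP=> h hH; apply/eqP; rewrite eqEcard cardJg leqnn andbT.
  rewrite -genJ gen_subG; apply/subsetP=> _ /imsetP[x /bigcupP[b bB xb] ->].
  have bH := subsetP sBH b bB.
  by apply: (subsetP (allN (b * h) (groupM bH hH))); rewrite conjsgM memJ_conjg.
case/andP: (B0) => /card_gt0P[b bB] _; have bH := subsetP sBH b bB.
pose V := [group of U :^ b].
have sVN : V \subset NB by apply: sub_gen; apply: (bigcup_max b).
have cardV : #|V| = #|U| by rewrite cardJg.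
have indV : #|NB : V| <= n.+1 * M ^ r.
  rewrite -(leq_pmul2l (cardG_gt0 V)) Lagrange //.
  apply: leq_trans (smallN B sBH B0) _.
  by apply: leq_trans (leq_mul (leqnn _) leU) _; rewrite cardV mulnA mulnC.
have pV : p.-group V.
  rewrite pgroupJ; case/andP: Ar => /card_gt0P[a aA] _.
  by apply: pgroupS (conj_cap_sub P aA) _; rewrite pgroupJ.
(* [V] has bounded index in [NB], so its core there has bounded index in [V]; this core is a normal
   p-subgroup of [NB], which is normal in [H]. *)
have score : gcore V NB \subset 'O_p(H).
  apply: subset_trans (pcoreS_normal p nN); apply: pcore_max.
    exact: pgroupS (gcore_sub V NB) pV.
  exact: gcore_normal.
apply: leq_trans leU _.
apply: (@leq_trans (M ^ r * ((n.+1 * M ^ r)`! * #|'O_p(H)|))); last first.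
  by rewrite mulnA leq_mul2r leq_maxr orbT.
rewrite leq_mul2l -cardV; apply/orP; right.
apply: leq_trans (subset_leq_card sVN) _.
rewrite -(Lagrange (subset_trans (gcore_sub V NB) sVN)) mulnC leq_mul ?subset_leq_card //.
apply: leq_trans (index_gcore_leq _ _) _; exact: leq_fact.
Qed.

Lemma bergman_lenstra (M : nat) : exists C : nat,
  forall (gT : finGroupType) (H P : {group gT}) (p : nat),
    p.-group P -> P \subset H -> {in H, forall h, #|P : P :^ h| <= M} ->
  #|P| <= C * #|'O_p(H)|.
Proof.
have [C hC] := bergman_lenstra_step M M 1.
exists C => gT H P p pP sPH PM; apply: (hC gT H P p [set 1]) => //.
- by rewrite sub1set group1.
- by rewrite cards1.
- move=> h hH; rewrite /conj_cap big_set1 conjsg1; exact: PM.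
Qed.

(** * The index of F(T) in T *)

(** [P :&: X] need not be Sylow in [X], but its order is at most the p-part of [#|X|], which
    suffices. *)
Lemma leq_part_index (gT : finGroupType) (p : nat) (T P X : {group gT}) :
  X \subset T -> p.-Sylow(T) P -> #|T : X|`_p <= #|P : X|.
Proof.
move=> sXT sylP.
have pPX : p.-group (P :&: X) := pgroupS (subsetIl _ _) (pHall_pgroup sylP).
have le1 : #|P :&: X| <= #|X|`_p.
  rewrite -(part_pnat_id pPX) dvdn_leq ?part_gt0 // partn_dvd ?cardSg ?subsetIr //.
rewrite -(leq_pmul2l (part_gt0 p #|X|)) -partnM ?indexg_gt0 ?cardG_gt0 // Lagrange //.
by rewrite -(card_Hall sylP) -(LagrangeI P X) leq_mul2r le1 orbT.
Qed.

(** A proper centralizer in [Q] has index at least [q], which exceeds [2 * N]; so the elements of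
    [R] commuting with a 1/(2N) fraction of [Q] centralize [Q]. *)
Lemma index_cent_large (gT : finGroupType) (N q : nat) (Q R : {group gT}) :
  prime q -> q.-group Q -> 2 * N < q -> cfrac N R Q -> #|R : 'C(Q)| <= 2 * N.
Proof.
move=> q_pr qQ Nq hRQ.
have leQ x : x \in R -> #|'C_Q[x]| <= #|Q| by rewrite subset_leq_card ?subsetIl.
have := markov_card (cardG_gt0 Q) leQ hRQ; set X := finset _ => leX.
have sX : X \subset 'C_R(Q).
  apply/subsetP=> x; rewrite !inE => /andP[xR hx]; rewrite xR /=.
  suff sQC : Q \subset 'C[x] by rewrite -sub1set centsC -cent_set1 in sQC *.
  have : #|Q : 'C[x]| <= 2 * N.
    rewrite -(leq_pmul2l (cardG_gt0 [group of Q :&: 'C[x]])) LagrangeI.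
    by rewrite mulnC.
  have : q.-nat #|Q : 'C[x]| by apply: pnat_dvd qQ; apply: dvdn_indexg.
  case/p_natP=> k; rewrite -indexg_eq1 => ->; case: k => // k; rewrite expnS => le2.
  have := prime_gt0 q_pr; have : 0 < q ^ k by rewrite expn_gt0 prime_gt0.
  nia.
rewrite -(leq_pmul2l (cardG_gt0 [group of R :&: 'C(Q)])) LagrangeI mulnC.
by apply: leq_trans leX _; rewrite leq_mul2l subset_leq_card ?orbT.
Qed.

(** This is [weight_subgroup] for the weight [#|Q : 'C[x]|], submultiplicative because the
    centralizer of a product contains the intersection of the centralizers. *)
Lemma index_cent1_subgroup (N : nat) : 0 < N -> exists k : nat,
  forall (gT : finGroupType) (P Q : {group gT}), cfrac N P Q ->
  exists P1 : {group gT}, [/\ P1 \subset P, #|P : P1| <= 2 * N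
    & {in P1, forall x, #|Q : 'C[x]| <= k}].
Proof.
move=> N0; have [k hk] := weight_subgroup (2 * N) (2 * N).
exists k => gT P Q hPQ.
have leQ x : x \in P -> #|'C_Q[x]| <= #|Q| by rewrite subset_leq_card ?subsetIl.
have := markov_card (cardG_gt0 Q) leQ hPQ; set X := finset _ => leX.
have [|||||P1 [sP1 iP1 _ P1k]] := hk gT P (fun x => #|Q : 'C[x]|).
- move=> x y _ _; apply: leq_trans (leq_indexI Q _ _).
  apply: leq_indexgS; apply/subsetP=> z /setIP[/cent1P zx /cent1P zy].
  by apply/cent1P; apply: commuteM.
- by move=> x _; rewrite -!cent_cycle cycleV.
- by rewrite muln_gt0 N0.
- by rewrite cent11T (_ : #|Q : setT| = 1%N) ?muln_gt0 //; apply/eqP; rewrite indexg_eq1 subsetT.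
- apply: leq_trans leX _; rewrite leq_mul2l; apply/orP; right; apply: subset_leq_card.
  apply/subsetP=> x; rewrite !inE => /andP[-> hx] /=.
  by rewrite -(leq_pmul2l (cardG_gt0 [group of Q :&: 'C[x]])) LagrangeI mulnC.
by exists P1.
Qed.

(** Bounding each prime part shows that there are at most [b ^ b.+1] Sylow q-subgroups; their number
    is congruent to 1 modulo [q] and below [q], so it is 1. *)
Lemma index_norm_Sylow (b : nat) (gT : finGroupType) (q : nat) (T Q : {group gT}) :
  q.-Sylow(T) Q -> prime q -> b ^ b.+1 < q -> 0 < b ->
  (forall r, prime r -> r \in \pi(T) -> r != q ->
     exists2 R : {group gT}, r.-Sylow(T) R & #|R : 'C(Q)| <= b) ->
  Q <| T.
Proof.
move=> sylQ q_pr bq b0 hR.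
have sQT := pHall_sub sylQ.
have le_b : #|T : 'N_T(Q)| <= b ^ b.+1.
  apply: leq_partn_bound => // r r_pr.
  have [->|nrq] := eqVneq r q.
    apply: leq_trans (leq_part_index _ sylQ) _; first exact: subsetIl.
    apply: leq_trans b0; rewrite leq_eqVlt ltnS; apply/orP; left.
    by rewrite indexg_eq1 subsetI sQT normG.
  have [rT|rT] := boolP (r \in \pi(T)).
    have [R sylR leR] := hR r r_pr rT nrq.
    apply: leq_trans (leq_part_index _ sylR) _; first exact: subsetIl.
    apply: leq_trans leR; rewrite -[X in X <= _]indexgI -[X in _ <= X]indexgI.
    rewrite leq_indexgS // subsetI subsetIl subsetI subIset ?(pHall_sub sylR) //=.
    by apply: subset_trans (subsetIr _ _) (cent_sub _).
  rewrite part_p'nat ?b0 //; apply: pnat_dvd (dvdn_indexg _ _) _.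
  by rewrite -p'groupEpi in rT.
have := card_Syl_mod T q_pr; rewrite (card_Syl sylQ) modn_small; last exact: leq_ltn_trans bq.
by move/eqP; rewrite indexg_eq1 subsetI => /andP[_ nQ]; apply/andP.
Qed.

(** Some [P :^ h] contains a Sylow p-subgroup of the centralizer of [x], and [x] with it.
    Multiplying [h] on the right by elements of [P :^ h] and then of the centralizer keeps [x] in
    the conjugate; the size of this set gives the bound. *)
Lemma card_conj_mem_leq (gT : finGroupType) (p : nat) (T P : {group gT}) (x : gT) :
  p.-Sylow(T) P -> x \in P ->
  #|T| <= #|T : 'C_T[x]|`_p^' * #|[set g in T | x \in P :^ g]|.
Proof.
move=> sylP xP; have sPT := pHall_sub sylP; have xT := subsetP sPT x xP.
pose C := [group of 'C_T[x]]; have sCT : C \subset T by apply: subsetIl.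
have px : p.-elt x := mem_p_elt (pHall_pgroup sylP) xP.
have [S sylS] := Sylow_exists p C.
have xS : x \in S.
  have : <[x]> \subset 'O_p(C).
    apply: pcore_max => //; apply: sub_center_normal.
    rewrite cycle_subG; apply/centerP; split.
      by rewrite inE xT cent1id.
    by move=> c /setIP[_ /cent1P].
  by move/subset_trans/(_ (pcore_sub_Hall sylS)); rewrite cycle_subG.
have [h hT sSPh] := Sylow_subJ sylP (subset_trans (pHall_sub sylS) sCT) (pHall_pgroup sylS).
have sPhT : P :^ h \subset T by rewrite conj_subG.
have sub : h *: (P :^ h * C) \subset [set g in T | x \in P :^ g].
  apply/subsetP=> _ /lcosetP[_ /mulsgP[u c uP cC ->] ->].
  have cT := subsetP sCT c cC; have uT := subsetP sPhT u uP.
  rewrite inE !groupM //= conjsgM conjsgM (conjGid uP).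
  case/setIP: cC => _ /cent1P xc.
  have <- : x ^ c = x by rewrite conjgE -xc mulKg.
  by rewrite memJ_conjg (subsetP sSPh).
have := subset_leq_card sub; rewrite card_lcoset => le1.
apply: leq_trans (leq_mul (leqnn _) le1).
have le2 : #|P :^ h :&: C| <= #|C|`_p.
  have pPC : p.-group (P :^ h :&: C).
    by apply: pgroupS (subsetIl _ _) _; rewrite pgroupJ (pHall_pgroup sylP).
  by rewrite -(part_pnat_id pPC) dvdn_leq ?part_gt0 // partn_dvd ?cardSg ?subsetIr.
have eq1 := mul_cardG [group of P :^ h] C; rewrite /= cardJg (card_Hall sylP) in eq1.
have eq2 := Lagrange sCT.
have eq3 : (#|C|`_p^' * #|T : C|`_p^' = #|T|`_p^')%N by rewrite -partnM // eq2.
have C0 : 0 < #|C|`_p by apply: part_gt0.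
have arith (a c c' t u v : nat) : v <= c -> (t * (c * c') = u * v)%N ->
    c * (t * (c' * a)) <= c * (a * u).
  move=> vc e; have -> : (c * (t * (c' * a)) = t * (c * c') * a)%N by rewrite mulnCA !mulnA.
  have -> : (c * (a * u) = u * c * a)%N by rewrite mulnA mulnC mulnA.
  by rewrite e !leq_mul2r leq_mul2l vc !orbT.
rewrite -(leq_pmul2l C0) -{1}(partnC p (cardG_gt0 T)) -eq3.
by apply: arith le2 _; rewrite partnC.
Qed.

(** The core of [H] in [T] meets ['O_p(H)] in a normal p-subgroup of the core, hence inside
    ['O_p(T)]. *)
Lemma pcore_index_core (gT : finGroupType) (p : nat) (T H : {group gT}) :
  H \subset T -> #|'O_p(H)| <= #|T : H|`! * #|'O_p(T)|.
Proof.
move=> sHT; set H0 := [group of gcore H T].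
have sH0H : H0 \subset H by apply: gcore_sub.
have sO : 'O_p(H) :&: H0 \subset 'O_p(T).
  apply: subset_trans (pcoreS_normal p (gcore_normal sHT)); apply: pcore_max.
    by apply: pgroupS (subsetIl _ _) (pcore_pgroup _ _).
  rewrite /normal subsetIr normsI ?normG //.
  by apply: subset_trans sH0H _; rewrite gFnorm.
rewrite -(LagrangeI 'O_p(H) H0) mulnC leq_mul ?subset_leq_card //.
apply: leq_trans (index_gcore_leq T H); rewrite leq_indexSg //.
exact: subset_trans (pcore_sub _ _) sHT.
Qed.

(* By averaging over T, a positive proportion of the conjugates of P meet P in a
   subgroup of bounded index. *)
Lemma card_Sylow_leq_pcore (m D : nat) : 0 < m -> exists C : nat,
  forall (gT : finGroupType) (p : nat) (T P P1 : {group gT}),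
    p.-Sylow(T) P -> P1 \subset P -> #|P : P1| <= D ->
    {in P1, forall x, #|T| <= m * #|[set g in T | x \in P :^ g]|} ->
  #|P| <= C * #|'O_p(T)|.
Proof.
move=> m0; have [M hM] := weight_subgroup (D * (2 * m)) (2 * m).
have [C hC] := bergman_lenstra M.
exists (C * (2 * m)`!)%N => gT p T P P1 sylP sP1 iP1 P1m.
have sPT := pHall_sub sylP.
have leP g : g \in T -> #|P1 :&: P :^ g| <= #|P1| by rewrite subset_leq_card ?subsetIl.
have sum : #|T| * #|P1| <= m * \sum_(g in T) #|P1 :&: P :^ g|.
  have -> : \sum_(g in T) #|P1 :&: P :^ g|
          = \sum_(x in P1) #|[set g in T | x \in P :^ g]|.
    under eq_bigr => g _ do rewrite -sum1_card.
    under [RHS]eq_bigr => x _ do rewrite -sum1_card.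
    rewrite (exchange_big_dep (mem P1)) /=; last by move=> g x _ /setIP[].
    by apply: eq_bigr => x xP1; apply: eq_bigl => g; rewrite !inE xP1.
  rewrite mulnC -sum_nat_const big_distrr /=; exact: leq_sum.
have := markov_card (cardG_gt0 P1) leP sum; set X := finset _ => leX.
have D0 : 0 < D by apply: leq_trans iP1; apply: indexg_gt0.
(* The weight is the index of [P :&: P :^ g] in [P]. Elements of [P] have weight 1, so [P] ends up
   inside [H]. *)
have [|||||H [sHT iH ballH HM]] := hM gT T (fun g => #|P : P :^ g|).
- move=> x y xT yT; rewrite conjsgM.
  apply: (@leq_trans #|P : P :^ y :&: (P :^ x) :^ y|).
    by rewrite leq_indexgS ?subsetIr.
  rewrite -indexgI setIA -(@Lagrange_index _ P (P :&: P :^ y)) ?subsetIl // indexgI mulnC.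
  by rewrite -(indexJg P (P :^ x) y) leq_mul // indexgI leq_indexSg ?subsetIr.
- move=> x xT; rewrite -(indexJg P _ x) -conjsgM mulVg conjsg1.
  apply/eqP; rewrite -(eqn_pmul2l (cardG_gt0 [group of P :&: P :^ x])) LagrangeI /=.
  by rewrite setIC -(cardJg P x) (LagrangeI [group of P :^ x] P).
- by rewrite !muln_gt0 D0 m0.
- by rewrite conjsg1 indexgg !muln_gt0 D0 m0.
- apply: leq_trans leX _; rewrite leq_mul2l; apply/orP; right; apply: subset_leq_card.
  apply/subsetP=> g; rewrite !inE => /andP[-> hg] /=.
  apply: (@leq_trans #|P : P1 :&: P :^ g|); first by rewrite leq_indexgS ?subsetIr.
  rewrite -(@Lagrange_index _ P P1) ?subsetIl // leq_mul //.
  by rewrite -(leq_pmul2l (cardG_gt0 [group of P1 :&: P :^ g])) Lagrange ?subsetIl // mulnC.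
have sPH : P \subset H.
  apply: subset_trans ballH; apply/subsetP=> g gP.
  by rewrite inE (subsetP sPT) //= conjGid // indexgg !muln_gt0 D0 m0.
apply: leq_trans (hC gT H P p (pHall_pgroup sylP) sPH HM) _.
rewrite -mulnA leq_mul2l; apply/orP; right.
apply: leq_trans (pcore_index_core p sHT) _.
by rewrite leq_mul2r leq_fact ?orbT.
Qed.

Section SelfCommuting.

Variables (N : nat) (N0 : 0 < N).
Variables (gT : finGroupType) (T : {group gT}).
Hypothesis cfracT : forall p q : nat, p \in \pi(T) -> q \in \pi(T) -> p != q ->
  exists P Q : {group gT}, [/\ p.-Sylow(T) P, q.-Sylow(T) Q & cfrac N P Q].

Lemma Sylow_cfrac (p q : nat) (P : {group gT}) :
  p.-Sylow(T) P -> p \in \pi(T) -> q \in \pi(T) -> p != q ->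
  exists2 Q : {group gT}, q.-Sylow(T) Q & cfrac N P Q.
Proof.
move=> sylP pT qT npq; have [P' [Q [sylP' sylQ hPQ]]] := cfracT pT qT npq.
have [x xT ->] := Sylow_trans sylP' sylP.
by exists (Q :^ x)%G; [rewrite pHallJ | apply: cfracJ].
Qed.

(** The threshold serves twice: it exceeds [2 * N], as [index_cent_large] needs, and it is
    [b ^ b.+1] with [b = 2 * N], as [index_norm_Sylow] needs. *)
Lemma large_Sylow_normal (q : nat) (Q : {group gT}) :
  q.-Sylow(T) Q -> prime q -> (2 * N) ^ (2 * N).+1 < q -> Q <| T.
Proof.
move=> sylQ q_pr bq.
have N2 : 0 < 2 * N by rewrite muln_gt0 N0.
have [qT|] := boolP (q \in \pi(T)); last first.
  rewrite -p'groupEpi => q'T.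
  have -> : Q :=: 1 by apply/eqP; rewrite trivg_card1 (card_Hall sylQ) partG_eq1.
  exact: normal1.
apply: (index_norm_Sylow sylQ q_pr bq N2) => r r_pr rT; rewrite eq_sym => nqr.
have [R sylR hQR] := Sylow_cfrac sylQ qT rT nqr.
exists R => //; apply: index_cent_large q_pr (pHall_pgroup sylQ) _ (cfracC hQR).
by apply: leq_ltn_trans bq; rewrite -{1}(expn1 (2 * N)) leq_pexp2l.
Qed.

Hypothesis centT : forall (p q : nat) (P : {group gT}),
  p.-Sylow(T) P -> p != q -> P \subset 'C('O_q(T)).

Variable k : nat.
Hypothesis cent1_subgroup : forall P Q : {group gT}, cfrac N P Q ->
  exists P1 : {group gT}, [/\ P1 \subset P, #|P : P1| <= 2 * N
    & {in P1, forall x, #|Q : 'C[x]| <= k}].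

(** Above the threshold a Sylow q-subgroup is ['O_q(T)], which [P] centralizes, so the q-part is 1.
    For the primes up to the threshold, subgroups of index at most [2 * N] are intersected one after
    another. *)
Lemma Sylow_small_p'_classes (p : nat) (P : {group gT}) :
  p.-Sylow(T) P -> p \in \pi(T) ->
  exists P1 : {group gT}, [/\ P1 \subset P,
      #|P : P1| <= (2 * N) ^ ((2 * N) ^ (2 * N).+1).+1
    & {in P1, forall x, #|T : 'C_T[x]|`_p^' <= k.+1 ^ k.+2}].
Proof.
move=> sylP pT; set b := ((2 * N) ^ (2 * N).+1)%N; have sPT := pHall_sub sylP.
have part_leq (q : nat) (Q : {group gT}) x : x \in P -> q.-Sylow(T) Q ->
    #|T : 'C_T[x]|`_q <= #|Q : 'C[x]|.
  move=> xP sylQ; apply: leq_trans (leq_part_index _ sylQ) _; first exact: subsetIl.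
  by rewrite /= -indexgI setIA (setIidPl (pHall_sub sylQ)) indexgI.
suff [P1 [sP1 iP1 P1k]] : exists P1 : {group gT}, [/\ P1 \subset P,
    #|P : P1| <= (2 * N) ^ b.+1
    & forall x q, x \in P1 -> q < b.+1 -> q \in \pi(T) -> p != q ->
        #|T : 'C_T[x]|`_q <= k.+1].
  exists P1; split=> // x xP1; have xP := subsetP sP1 x xP1.
  apply: leq_partn_bound => // q q_pr.
  have [->|nqp] := eqVneq p q.
    by rewrite (part_p'nat (part_pnat _ _)).
  rewrite partn_part; last by move=> r; rewrite !inE => /eqnP->; rewrite eq_sym.
  have [qT|qT] := boolP (q \in \pi(T)); last first.
    rewrite part_p'nat //; apply: pnat_dvd (dvdn_indexg _ _) _.
    by rewrite -p'groupEpi in qT.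
  have [bq|] := leqP q b; first exact: P1k.
  move=> bq; have [Q sylQ] := Sylow_exists q T.
  apply: leq_trans (part_leq q Q x xP sylQ) _.
  apply: (@leq_trans 1) => //; rewrite leq_eqVlt ltnS; apply/orP; left.
  rewrite indexg_eq1 -(normal_Hall_pcore sylQ (large_Sylow_normal sylQ q_pr bq)).
  rewrite sub_cent1.
  exact: (subsetP (centT sylP nqp)).
elim: b.+1 => [|j [P1 [sP1 iP1 P1k]]].
  by exists P; rewrite indexgg expn0; split.
have [jT|njT] := boolP ((j \in \pi(T)) && (p != j)); last first.
  exists P1; split=> // [|x q xP1].
    by apply: leq_trans iP1 _; rewrite leq_pexp2l // muln_gt0 N0.
  rewrite ltnS leq_eqVlt => /predU1P[->|]; last exact: P1k.
  by move=> jT npj; rewrite jT npj in njT.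
case/andP: jT => jT npj; have [Q sylQ hPQ] := Sylow_cfrac sylP pT jT npj.
have [P2 [sP2 iP2 P2k]] := cent1_subgroup hPQ.
exists [group of P1 :&: P2]; split=> [||x q /setIP[xP1 xP2]].
- by rewrite subIset ?sP1.
- by apply: leq_trans (leq_indexI _ _ _) _; rewrite expnSr leq_mul.
rewrite ltnS leq_eqVlt => /predU1P[->|]; last exact: P1k.
move=> _ _; apply: leq_trans (part_leq j Q x (subsetP sP1 x xP1) sylQ) _.
exact/leqW/P2k.
Qed.

End SelfCommuting.

(** Each p-part is at most the index of ['O_p(T)] in a Sylow p-subgroup [P]. Bounded p'-parts of
    class sizes put the elements of a large subgroup of [P] in many conjugates of [P], as
    [card_Sylow_leq_pcore] requires. *)
Lemma index_Fitting_leq (N : nat) : 0 < N -> exists t : nat,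
  forall (gT : finGroupType) (T : {group gT}),
    (forall p q : nat, p \in \pi(T) -> q \in \pi(T) -> p != q ->
      exists P Q : {group gT}, [/\ p.-Sylow(T) P, q.-Sylow(T) Q & cfrac N P Q]) ->
    (forall (p q : nat) (P : {group gT}),
      p.-Sylow(T) P -> p != q -> P \subset 'C('O_q(T))) ->
  #|T : 'F(T)| <= t.
Proof.
move=> N0; have [k hk] := index_cent1_subgroup N0.
pose D := ((2 * N) ^ ((2 * N) ^ (2 * N).+1).+1)%N.
have [|C hC] := @card_Sylow_leq_pcore (k.+1 ^ k.+2) D; first by rewrite expn_gt0.
exists (C.+1 ^ C.+2)%N => gT T cfracT centT.
apply: leq_partn_bound => // p p_pr.
have [P sylP] := Sylow_exists p T.
have sOP : 'O_p(T) \subset P :&: 'F(T).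
  by rewrite subsetI pcore_sub_Hall // -p_core_Fitting pcore_sub.
apply: leq_trans (leq_part_index (Fitting_sub T) sylP) _.
rewrite -indexgI; apply: leq_trans (leq_indexgS P sOP) _.
have sOP' : 'O_p(T) \subset P by apply: pcore_sub_Hall.
rewrite -(leq_pmul2l (cardG_gt0 'O_p(T))) Lagrange //.
have [pT|] := boolP (p \in \pi(T)); last first.
  rewrite -p'groupEpi => p'T; rewrite (card_Hall sylP).
  by move: p'T; rewrite -partG_eq1 => /eqP->; rewrite muln_gt0 cardG_gt0.
have [P1 [sP1 iP1 P1m]] := Sylow_small_p'_classes N0 cfracT centT (hk gT) sylP pT.
rewrite mulnC; apply: (@leq_trans (C * #|'O_p(T)|)); last by rewrite leq_mul2r leqnSn orbT.
apply: (hC _ _ _ _ _ sylP sP1 iP1) => x xP1.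
apply: leq_trans (card_conj_mem_leq sylP (subsetP sP1 x xP1)) _.
by rewrite leq_mul2r P1m ?orbT.
Qed.

(** * Coprime action *)

Lemma coprime_cent_prod (gT : finGroupType) (A G : {group gT}) :
  A \subset 'N(G) -> coprime #|G| #|A| -> solvable G -> [~: G, A] * 'C_G(A) = G.
Proof.
move=> nGA coGA solG; have sRG : [~: G, A] \subset G by rewrite commg_subl.
apply/eqP; rewrite eqEsubset mul_subG ?subsetIl //=.
rewrite -quotientSK ?commg_norml // coprime_norm_quotient_cent ?commg_normr //.
- by rewrite subsetI subxx quotient_cents2r.
- exact: coprimeSg coGA.
- exact: solvableS solG.
Qed.

Lemma coprime_cent_Phi (gT : finGroupType) (A G : {group gT}) :
  A \subset 'N(G) -> coprime #|G| #|A| -> solvable G ->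
  [~: G, A] \subset 'Phi(G) -> A \subset 'C(G).
Proof.
move=> nGA coGA solG sRPhi; rewrite centsC; apply/setIidPl.
rewrite -[RHS](@Phi_nongen _ G 'C_G(A)) ?genGid //.
apply/eqP; rewrite eqEsubset join_subG Phi_sub subsetIl /=.
rewrite -{1}(coprime_cent_prod nGA coGA solG).
by rewrite mulG_subG (subset_trans sRPhi) ?joing_subl ?joing_subr.
Qed.

(** Induction on [n]. An element [y] of [Q], nontrivial and central modulo ['C_Q(V)], splits [V]
    into a factor of order at most [n.+1] and ['C_V[y]]. A subgroup of bounded index in [Q]
    centralizes the first, and on the second it satisfies the hypothesis with [n]. *)
Lemma index_cent_coprime_abelian (n : nat) : exists f : nat,
  forall (gT : finGroupType) (V Q : {group gT}),
    abelian V -> nilpotent Q -> Q \subset 'N(V) -> coprime #|V| #|Q| ->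
    {in Q, forall y, #|V : 'C[y]| <= n} ->
  #|Q : 'C(V)| <= f.
Proof.
elim: n => [|n [f IHn]].
  by exists 0 => gT V Q _ _ _ _ /(_ 1 (group1 Q)); rewrite leqNgt indexg_gt0.
exists (maxn 1 (n.+1`! * f)) => gT V Q abV nilQ nVQ coVQ Vn.
have [cVQ|ncVQ] := boolP (Q \subset 'C(V)).
  by apply: leq_trans (leq_maxl _ _); rewrite leq_eqVlt indexg_eq1 cVQ.
apply: leq_trans (leq_maxr _ _).
pose C := [group of 'C_Q(V)].
have nCQ : C <| Q by rewrite /normal subsetIl normsI ?normG // norms_cent.
have nCQ' := normal_norm nCQ.
have ntQC : Q / C != 1.
  by rewrite -subG1 quotient_sub1 // subsetI subxx.
have : 'Z(Q / C) != 1 by rewrite center_nil_eq1 ?quotient_nil.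
case/trivgPn => ybar Zybar nt_ybar.
have /morphimP[y nCy yQ def_y] : ybar \in Q / C by apply: (subsetP (center_sub _)).
(* [Y] has the same fixed points in [V] as [y] but is normal in [Q], which makes [[~: V, Y]] and
   ['C_V(Y)] invariant under [Q]. *)
pose Y := [group of coset C @*^-1 (<[y]> / C)].
have sYQ : <[y]> \subset Q by rewrite cycle_subG.
have defY : Y :=: C * <[y]> by rewrite /= quotientK // cycle_subG.
have nYQ : Y <| Q.
  rewrite -(quotientGK nCQ) cosetpre_normal quotient_cycle // -/(coset C y).
  by rewrite sub_center_normal // cycle_subG -def_y.
have sYQ' := normal_sub nYQ.
have nVY : Y \subset 'N(V) := subset_trans sYQ' nVQ.
have coVY : coprime #|V| #|Y| := coprimegS sYQ' coVQ.
have yY : y \in Y by rewrite defY (subsetP (mulG_subr _ _)) ?cycle_id.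
have cVy : 'C_V[y] = 'C_V(Y).
  rewrite defY centM -cent_cycle setIA [V :&: 'C(C)](setIidPl _) //.
  by rewrite centsC subsetIr.
pose W := [group of [~: V, Y]]; pose V1 := [group of 'C_V(Y)].
have prodV : W * V1 = V by apply: coprime_cent_prod => //; apply: abelian_sol.
have sWV : W \subset V by rewrite /W commg_subl.
have tiWV : W :&: V1 = 1.
  have := coprime_abel_cent_TI nVY coVY abV.
  move=> <-.
  by rewrite /= setIA (setIidPl sWV).
have nWQ : Q \subset 'N(W) by apply: normsR => //; apply: normal_norm.
have nV1Q : Q \subset 'N(V1) by apply: normsI => //; apply/norms_cent/normal_norm.
have indV1 : #|V : V1| = #|W|.
  apply/eqP; rewrite -(eqn_pmul2l (cardG_gt0 V1)) Lagrange ?subsetIl //.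
  by rewrite -[in X in X == _]prodV (TI_cardMg tiWV) mulnC.
have W_le : #|W| <= n.+1 by rewrite -indV1 /= -cVy indexgI Vn.
have V1_gt1 : 1 < #|V : V1|.
  rewrite indexg_gt1 subsetI subxx /= centsC; apply: contra nt_ybar => cVY.
  rewrite def_y; apply/eqP/coset_id; rewrite inE yQ.
  by apply: (subsetP cVY).
pose Q1 := [group of 'C_Q(W)].
have sQ1Q : Q1 \subset Q by apply: subsetIl.
have fV1 : #|Q1 : 'C(V1)| <= f.
  apply: (IHn _ V1).
  - exact: abelianS (subsetIl _ _) abV.
  - exact: nilpotentS sQ1Q nilQ.
  - exact: subset_trans nV1Q.
  - exact: coprimeSg (subsetIl _ _) (coprimegS sQ1Q coVQ).
  move=> z /setIP[zQ cWz].
  (* With v = a b, a in [W] and b in [V1], conjugation by [y * z] gives a^y b^z. Comparing factors,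
     [y] fixes a, which is therefore trivial, and [z] fixes b. *)
  have sub : 'C_V[y * z] \subset V1 :&: 'C[z].
    apply/subsetP=> v /setIP[vV /cent1P cv].
    move: vV; rewrite -prodV => /mulsgP[a b aW bV1 def_v].
    have aV := subsetP sWV a aW.
    have ay : a ^ y \in W by rewrite memJ_norm // (subsetP nWQ).
    have bz : b ^ z \in V1 by rewrite memJ_norm // (subsetP nV1Q).
    have by_ : b ^ y = b.
      case/setIP: bV1 => _ /centP/(_ y yY) cby; by rewrite conjgE cby mulKg.
    have ayz : (a ^ y) ^ z = a ^ y.
      by rewrite conjgE -(centP cWz _ ay) mulKg.
    have : v ^ (y * z) = v by rewrite conjgE cv mulKg.
    rewrite def_v conjMg !conjgM ayz by_ => e.
    have e1 : a^-1 * a ^ y = b * (b ^ z)^-1.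
      by apply: (canRL (mulgK _)); rewrite -mulgA e mulKg.
    have t1 : a^-1 * a ^ y \in W :&: V1.
      apply/setIP; split; first by rewrite (groupM (groupVr aW) ay).
      by rewrite e1 (groupM bV1 (groupVr bz)).
    move: t1; rewrite tiWV => /set1P t1.
    have ay' : a ^ y = a by apply: (mulgI a^-1); rewrite t1 mulVg.
    have bz' : b ^ z = b.
      by apply: (mulgI a); rewrite -{1}ay' e.
    have : a \in W :&: V1.
      rewrite inE aW /= -cVy inE aV; apply/cent1P/commgP.
      by rewrite /commg ay' mulVg.
    rewrite tiWV => /set1P ->; rewrite mul1g inE bV1.
    by apply/cent1P/commgP; rewrite /commg bz' mulVg.
  have zz : y * z \in Q by rewrite groupM.
  (* The factor 2 comes from [V1] being proper in [V]; it lowers the bound from [n.+1] to [n]. *)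
  have le2 : 2 * #|V1 : 'C[z]| <= n.+1.
    apply: leq_trans (Vn _ zz); rewrite -[X in _ <= X]indexgI.
    apply: leq_trans (leq_indexgS V sub).
    rewrite -(@Lagrange_index _ V V1) ?subsetIl // leq_mul //.
    by rewrite indexgI.
  by rewrite -ltnS; apply: leq_trans le2; rewrite mul2n -addnn -addn1 leq_add2l indexg_gt0.
have sC : 'C_Q1(V1) \subset 'C(V).
  have -> : 'C(V) = 'C(W) :&: 'C(V1) by rewrite -centM prodV.
  apply/subsetIP; split; last exact: subsetIr.
  exact: subset_trans (subsetIl _ _) (subsetIr _ _).
rewrite -indexgI.
apply: (@leq_trans (#|Q : Q1| * #|Q1 : 'C_Q1(V1)|)).
  rewrite Lagrange_index ?subsetIl // leq_indexgS //.
  by rewrite subsetI sC subIset // sQ1Q.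
rewrite leq_mul //; last by rewrite indexgI.
by apply: leq_trans (index_cent_leq _) _ => //; apply: leq_fact.
Qed.

(** The abelian case applies to [V / 'Phi(V)] and a subgroup of bounded index in [Q]; by
    coprimality, what acts trivially on that quotient centralizes [V]. *)
Lemma index_cent_coprime_cfrac (N : nat) : 0 < N -> exists f : nat,
  forall (gT : finGroupType) (p q : nat) (V Q : {group gT}),
    p.-group V -> q.-group Q -> p != q -> Q \subset 'N(V) -> cfrac N Q V ->
  #|Q : 'C(V)| <= f.
Proof.
move=> N0; have [k hk] := index_cent1_subgroup N0.
have [f hf] := index_cent_coprime_abelian k.
exists (2 * N * f)%N => gT p q V Q pV qQ npq nVQ hQV.
have [Q0 [sQ0 iQ0 Q0k]] := hk gT Q V hQV.
have coVQ0 : coprime #|V| #|Q0|.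
  by apply: pnat_coprime pV (pi_p'group (pgroupS sQ0 qQ) _); rewrite !inE.
have nVQ0 := subset_trans sQ0 nVQ.
pose F := [group of 'Phi(V)].
have nFQ0 : Q0 \subset 'N(F) by apply: gFnorm_trans.
have nFV : V \subset 'N(F) by apply: gFnorm.
have leQ0 : #|Q0 / F : 'C(V / F)| <= f.
  apply: hf.
  - exact: abelem_abelian (Phi_quotient_abelem pV).
  - by apply: quotient_nil; apply: pgroup_nil (pgroupS sQ0 qQ).
  - exact: quotient_norms.
  - exact: coprime_morph.
  move=> _ /morphimP[y ny yQ0 ->].
  have sub : 'C_V[y] / F \subset 'C[coset F y].
    by apply: subset_trans (quotientS _ (subsetIr _ _)) (quotient_cent1 _ _).
  apply: leq_trans (leq_indexgS (V / F) sub) _.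
  apply: leq_trans (Q0k y yQ0); rewrite -(indexgI V 'C[y]).
  by rewrite dvdn_leq ?indexg_gt0 // index_quotient // subIset // nFV.
pose Q2 := [group of Q0 :&: coset F @*^-1 'C(V / F)].
have sQ2Q0 : Q2 \subset Q0 by apply: subsetIl.
have cQ2 : Q2 \subset 'C(V).
  apply: coprime_cent_Phi.
  - exact: subset_trans nVQ0.
  - exact: coprimegS coVQ0.
  - exact: pgroup_sol pV.
  rewrite commGC -quotient_cents2 ?(subset_trans sQ2Q0) //.
  by apply: subset_trans (quotientS _ (subsetIr _ _)) _; rewrite cosetpreK.
apply: leq_trans (leq_indexgS Q cQ2) _.
rewrite -(@Lagrange_index _ Q Q0) // leq_mul //.
rewrite indexgI; apply: leq_trans leQ0.
rewrite -(index_cosetpre (Q0 / F) 'C(V / F)) leq_indexSg //.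
by rewrite -sub_quotient_pre.
Qed.

(** * Components *)

(** Climbing the derived series from its trivial end: an abelian term is central, so the term before
    it has class at most 2, hence is nilpotent and central as well. *)
Lemma solvable_Fitting_center (gT : finGroupType) (G : {group gT}) :
  solvable G -> 'F(G) \subset 'Z(G) -> abelian G.
Proof.
move=> solG sFZ.
have abF (H : {group gT}) : H <| G -> nilpotent H -> H \subset 'Z(G).
  by move=> nHG nilH; apply: subset_trans sFZ; apply: Fitting_max.
have [n Gn] := derivedP _ solG.
suff main m : m <= n -> abelian G^`(n - m) by have := main n (leqnn n); rewrite subnn.
elim: m => [_|m IHm mn]; first by rewrite subn0 Gn abelian1.
have abG1 := IHm (ltnW mn).
have sZ : G^`(n - m) \subset 'Z(G) by apply: abF; rewrite ?gFnormal ?abelian_nil.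
have eS : (n - m = (n - m.+1).+1)%N by rewrite subnSK.
rewrite eS in sZ; set D := [group of G^`(n - m.+1)].
have nilD : nilpotent D.
  apply: small_nil_class; apply: (@leq_trans 2) => //; rewrite nil_class2.
  rewrite subsetI der_sub /=; apply: subset_trans sZ _.
  by apply: subset_trans (subsetIr _ _) (centS (der_sub _ _)).
exact: abelianS (abF D (gFnormal _ _) nilD) (center_abelian G).
Qed.

Lemma Fitting_subnormal (gT : finGroupType) (M G : {group gT}) :
  M <|<| G -> 'F(M) \subset 'F(G).
Proof.
have [n] := ubnP #|G|; elim: n M G => // n IHn M G ltGn snMG.
have [-> //|[L [snML nLG ltLG]]] := subnormalEr snMG.
apply: subset_trans (IHn M L _ snML) _; first exact: leq_trans (proper_card ltLG) _.
by apply: Fitting_max; rewrite ?gFnormal_trans ?Fitting_nil.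
Qed.

(** A form without quotients, used to recognize components. If H Z(K) = K then K/H is abelian, and
    perfectness gives H = K. *)
Lemma quasisimpleP (gT : finGroupType) (K : {group gT}) :
  reflect [/\ K^`(1) = K, K :!=: 1
            & forall H : {group gT}, H <| K -> H :=: K \/ H \subset 'Z(K)]
          (quasisimple K).
Proof.
have nZ := center_normal K.
apply: (iffP and3P) => [[/eqP defK /simpleP[ntKZ simK] nabKZ] | [defK ntK simK]].
  split=> //.
    by apply: contraNneq nabKZ => ->; rewrite quotient1 abelian1.
  move=> H nHK; have [sHK nHK'] := andP nHK.
  have nZH : H \subset 'N('Z(K)) := subset_trans sHK (normal_norm nZ).
  have [/eqP|eKZ] := simK (H / 'Z(K))%G (quotient_normal _ nHK).
    by rewrite -subG1 quotient_sub1 //; right.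
  left; apply/eqP; rewrite eqEsubset sHK -{1}defK; apply: der1_min => //.
  have : K \subset 'Z(K) * H by rewrite -quotientSK ?normal_norm // eKZ.
  move/(quotientS H); rewrite quotientMidr => sKZ.
  exact: abelianS sKZ (quotient_abelian _ (center_abelian K)).
have nabK : ~~ abelian K by apply: contra ntK => /derG1P; rewrite defK => ->.
split; first exact/eqP.
  apply/simpleP; split.
    apply: contra nabK; rewrite -subG1 quotient_sub1 ?normal_norm // => sKZ.
    exact: abelianS sKZ (center_abelian K).
  move=> Hb nHb; pose H := [group of coset 'Z(K) @*^-1 Hb].
  have nHK : H <| K by rewrite -(quotientGK nZ) cosetpre_normal.
  have defHb : Hb :=: H / 'Z(K) by rewrite /= cosetpreK.
  have [eH|sHZ] := simK H nHK; [right | left]; rewrite defHb ?eH //.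
  by apply/trivgP; apply: subset_trans (quotientS _ sHZ) _; rewrite trivg_quotient.
apply: contra nabK => abKZ.
have : K \subset 'Z(K) by rewrite -{1}defK der1_min ?normal_norm.
by move/abelianS; apply; apply: center_abelian.
Qed.

Lemma quasisimpleJ (gT : finGroupType) (K : {group gT}) x :
  quasisimple K -> quasisimple (K :^ x).
Proof.
case/quasisimpleP=> defK ntK simK; apply/quasisimpleP; split=> [||H nH].
- by rewrite derg1 -conjsRg -derg1 defK.
- by rewrite trivg_card1 cardJg -trivg_card1.
have [|eH|sHZ] := simK (H :^ x^-1)%G.
- by rewrite -(normalJ _ _ x) conjsgKV.
- by left; rewrite /= -eH /= conjsgKV.
- by right; rewrite /center /= centJ -conjIg -sub_conjgV.
Qed.

Lemma quasisimple_nonsolvable (gT : finGroupType) (K : {group gT}) :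
  quasisimple K -> ~~ solvable K.
Proof.
case/quasisimpleP=> defK ntK _; apply/negP=> solK.
by have := sol_der1_proper solK (subxx K) ntK; rewrite defK properxx.
Qed.

Lemma subnormalJ (gT : finGroupType) (K G : {group gT}) x :
  K <|<| G -> K :^ x <|<| G :^ x.
Proof.
have [n] := ubnP #|G|; elim: n K G => // n IHn K G ltGn snKG.
have [-> |[L [snKL nLG ltLG]]] := subnormalEr snKG; first exact: subnormal_refl.
apply: (@subnormal_trans _ (L :^ x)%G).
  by apply: IHn snKL; apply: leq_trans (proper_card ltLG) _.
by apply: normal_subnormal; rewrite normalJ.
Qed.

Lemma gen_Fitting_normal (gT : finGroupType) (G : {group gT}) :
  gen_Fitting G <| G.
Proof.
rewrite /normal gen_subG subUset Fitting_sub; apply/andP; split.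
  by apply/bigcupsP=> K /andP[/subnormal_sub].
apply: norms_gen; apply: normsU; first exact: gFnorm.
apply/subsetP=> x xG; rewrite inE; apply/subsetP=> _ /imsetP[y /bigcupP[K /andP[snK qK] yK] ->].
apply/bigcupP; exists (K :^ x)%G; last by rewrite memJ_conjg.
by rewrite /= quasisimpleJ // andbT -(conjGid xG) subnormalJ.
Qed.

Lemma Fitting_sub_gen_Fitting (gT : finGroupType) (G : {group gT}) :
  'F(G) \subset gen_Fitting G.
Proof. by apply: sub_gen; apply: subsetUl. Qed.

Lemma component_sub_gen_Fitting (gT : finGroupType) (K G : {group gT}) :
  K <|<| G -> quasisimple K -> K \subset gen_Fitting G.
Proof.
move=> snK qK; apply: sub_gen; apply: subset_trans (subsetUr _ _).
by apply: (bigcup_max K); rewrite ?snK.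
Qed.

(** If K = G, the nonsolvable [K] is not its own p-core, which is therefore central. Otherwise
    [[~: 'O_p(G), K]] lies in ['O_p(L)] for a proper normal L containing [K]; induction and the
    three subgroups lemma conclude, as [K] is perfect. *)
Lemma component_cent_pcore (gT : finGroupType) (p : nat) (K G : {group gT}) :
  K <|<| G -> quasisimple K -> K \subset 'C('O_p(G)).
Proof.
move=> snKG qK; have [defK ntK simK] := quasisimpleP K qK.
have [n] := ubnP #|G|; elim: n G snKG => // n IHn G snKG ltGn.
have [eKG|[L [snKL nLG ltLG]]] := subnormalEr snKG.
  rewrite -eKG centsC; have [eO|] := simK 'O_p(K)%G (pcore_normal _ _).
    have := quasisimple_nonsolvable qK; rewrite -eO.
    by rewrite (pgroup_sol (pcore_pgroup p K)).
  by rewrite subsetI => /andP[].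
have cKOL : K \subset 'C('O_p(L)).
  by apply: IHn => //; apply: leq_trans (proper_card ltLG) _.
have sKL := subnormal_sub snKL.
have sR : [~: 'O_p(G), K] \subset 'O_p(L).
  apply: (@subset_trans _ _ ('O_p(G) :&: L)).
    apply: subset_trans (commgS _ sKL) _.
    rewrite subsetI commg_subl commg_subr.
    by rewrite (subset_trans (normal_sub nLG)) ?gFnorm // (subset_trans (pcore_sub _ _)) ?normal_norm.
  apply: pcore_max; first exact: pgroupS (subsetIl _ _) (pcore_pgroup p G).
  rewrite /normal subsetIr normsI ?normG //.
  by rewrite (subset_trans (normal_sub nLG)) ?gFnorm.
have t1 : [~: 'O_p(G), K, K] = 1.
  by apply/commG1P; apply: subset_trans sR _; rewrite centsC.
have t2 : [~: K, 'O_p(G), K] = 1 by rewrite [[~: K, _]]commGC.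
have := three_subgroup t2 t1; rewrite -derg1 defK => /commG1P.
by [].
Qed.

(** A solvable subnormal M inside [D] has its Fitting subgroup in ['F(G)], hence central in M; so M
    is abelian and lies in ['F(G)]. Thus [D] is nonsolvable, and a minimal nonsolvable subnormal
    subgroup in [D] has only central proper normal subgroups. *)
Lemma component_exists (gT : finGroupType) (D G : {group gT}) :
  D <| G -> D \subset 'C('F(G)) -> ~~ (D \subset 'F(G)) ->
  exists N : {group gT}, [/\ N <|<| G, N \subset D & quasisimple N].
Proof.
move=> nDG cDF nDF.
have solcase (M : {group gT}) : M <|<| G -> M \subset D -> solvable M -> M \subset 'F(G).
  move=> snM sMD solM; apply: subset_trans (Fitting_subnormal snM).
  suff abM : abelian M by rewrite Fitting_max ?normal_refl ?abelian_nil.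
  apply: solvable_Fitting_center => //; rewrite subsetI Fitting_sub.
  rewrite centsC; apply: (subset_trans sMD (subset_trans cDF (centS _))).
  exact: Fitting_subnormal.
pose P (M : {group gT}) := [&& M <|<| G, M \subset D & ~~ solvable M].
have PD : P D.
  rewrite /P normal_subnormal // subxx; apply: contra nDF => solD.
  by apply: solcase => //; apply: normal_subnormal.
have [N /mingroupP[/and3P[snN sND nsolN] minN] _] := mingroup_exists PD.
exists N; split=> //; apply/quasisimpleP.
have normN (H : {group gT}) : H <| N -> H :=: N \/ solvable H.
  move=> nHN; have [|nsolH] := boolP (solvable H); [by right | left].
  apply: minN; last exact: normal_sub.
  apply/and3P; split=> //; last exact: subset_trans (normal_sub nHN) sND.
  exact: (subnormal_trans (normal_subnormal nHN) snN).
split.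
- have [//|solN'] := normN [group of N^`(1)] (gFnormal _ _).
  case/negP: nsolN; rewrite (series_sol (der_normal 1 N)) solN'.
  by rewrite abelian_sol // der_abelian.
- by apply: contraNneq nsolN => ->; apply: solvable1.
move=> H nHN; have [|solH] := normN H nHN; [by left | right].
have sHN := normal_sub nHN.
rewrite subsetI sHN centsC; apply: (subset_trans sND (subset_trans cDF (centS _))).
apply: (solcase _ _ _ solH); last exact: subset_trans sND.
exact: (subnormal_trans (normal_subnormal nHN) snN).
Qed.

(** A component inside [D] equals its derived subgroup, so it would lie in [[~: gen_Fitting G, D]]
    and be solvable. *)
Lemma sub_Fitting_gen_Fitting (gT : finGroupType) (D G : {group gT}) :
  D <| G -> D \subset 'C('F(G)) -> [~: gen_Fitting G, D] \subset 'F(G) ->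
  D \subset 'F(G).
Proof.
move=> nDG cDF sTD; apply: contraT => nDF.
have [N [snN sND qN]] := component_exists nDG cDF nDF.
case/negP: (quasisimple_nonsolvable qN).
apply: solvableS (nilpotent_sol (Fitting_nil G)).
have [<- _ _] := quasisimpleP N qN; apply: subset_trans sTD.
by rewrite derg1 commgSS // component_sub_gen_Fitting.
Qed.

(** The q-core here is ['O_q(G)]. The components and the q'-part of ['F(G)] centralize it, so
    [gen_Fitting G] acts on it as a q-group. *)
Lemma Sylow_gen_Fitting_cent (gT : finGroupType) (p q : nat) (P G : {group gT}) :
  p.-Sylow(gen_Fitting G) P -> p != q -> P \subset 'C('O_q(gen_Fitting G)).
Proof.
set T := gen_Fitting G => sylP npq; set V := 'O_q(T)%G.
have nTG : T <| G := gen_Fitting_normal G.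
have VG : V \subset 'O_q(G) := pcoreS_normal q nTG.
have sOT : 'O_q(G) \subset T.
  apply: subset_trans (Fitting_sub_gen_Fitting G).
  by rewrite -p_core_Fitting pcore_sub.
have eV : V :=: 'O_q(G).
  apply/eqP; rewrite eqEsubset VG pcore_max ?pcore_pgroup //.
  by rewrite /normal sOT (subset_trans (normal_sub nTG)) ?gFnorm.
pose C := [group of 'C(V)].
have nVT : T \subset 'N(V) by rewrite gFnorm.
have nCT : T \subset 'N(C) by rewrite norms_cent.
have qV : q.-group V by apply: pcore_pgroup.
have sTVC : T \subset V <*> C.
  rewrite gen_subG subUset; apply/andP; split.
    have [_ defF cFF _] := dprodP (nilpotent_pcoreC q (Fitting_nil G)).
    rewrite -{1}defF p_core_Fitting -eV mul_subG ?joing_subl //.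
    apply: subset_trans (joing_subr _ _).
    by rewrite /= eV -p_core_Fitting.
  apply/bigcupsP=> K /andP[snK qK]; apply: subset_trans (joing_subr _ _).
  by rewrite /= eV component_cent_pcore.
have qTC : q.-group (T / C).
  apply: pgroupS (quotientS C sTVC) _; rewrite /= quotientYidr ?quotient_pgroup //.
  exact: norms_cent (normG V).
have sPT := pHall_sub sylP.
have nCP := subset_trans sPT nCT.
suff : P \subset C by [].
rewrite -quotient_sub1 //.
have pPC := quotient_pgroup C (pHall_pgroup sylP).
have qPC := pgroupS (quotientS C sPT) qTC.
have : coprime #|P / C| #|P / C|.
  by apply: pnat_coprime pPC (pi_p'group qPC _); rewrite !inE.
by rewrite /coprime gcdnn -trivg_card1 => /eqP->.
Qed.

(** * Subgroups acting on each O_p(G) as a p-group *)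

Lemma mem_expg_fact (gT : finGroupType) (G R : {group gT}) (j : nat) x :
  R <| G -> #|G : R| <= j -> x \in G -> x ^+ j`! \in R.
Proof.
move=> nRG leRj xG; have nRx := subsetP (normal_norm nRG) x xG.
apply: coset_idr; first exact: groupX.
rewrite morphX //; apply/eqP; rewrite -order_dvdn.
apply: dvdn_trans (order_dvdG (mem_quotient R xG)) _.
by rewrite card_quotient ?normal_norm // dvdn_fact // indexg_gt0.
Qed.

(** [R] is the core of the product of [C] and a Sylow p-subgroup; that product has p'-index dividing
    [#|G : C|]. *)
Lemma big_pgroup_quotient (gT : finGroupType) (p h : nat) (G C : {group gT}) :
  C <| G -> #|G : C|`_p^' <= h ->
  exists R : {group gT}, [/\ R <| G, #|G : R| <= h`! & p.-group (R / C)].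
Proof.
move=> nCG leh; have [P sylP] := Sylow_exists p G.
have nCP := subset_trans (pHall_sub sylP) (normal_norm nCG).
pose B := [group of P <*> C].
have sBG : B \subset G by rewrite join_subG (pHall_sub sylP) normal_sub.
exists [group of gcore B G]; split; first exact: gcore_normal.
  apply: leq_trans (index_gcore_leq G B) (leq_fact _); apply: leq_trans leh.
  apply: dvdn_leq; first exact: part_gt0.
  have p'B : p^'.-nat #|G : B|.
    have [_ _] := and3P sylP; apply: pnat_dvd; apply: indexgS.
    exact: joing_subl.
  by rewrite -(part_pnat_id p'B) partn_dvd ?indexg_gt0 ?indexgS ?joing_subr.
apply: pgroupS (quotientS C (gcore_sub B G)) _.
by rewrite /= quotientYidr // quotient_pgroup // (pHall_pgroup sylP).
Qed.

(** For q other than p, a Sylow p-subgroup of [M] acts trivially on ['O_q(G)]. So it lies in [D],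
    the centralizer in [M] of the p'-part of ['F(G)], and it remains to see that the normal subgroup
    [D] is nilpotent. *)
Lemma sub_Fitting_pgroup_action (gT : finGroupType) (G M : {group gT}) :
  M <| G -> [~: gen_Fitting G, M] \subset 'F(G) ->
  (forall p, prime p -> p.-group (M / 'C_G('O_p(G)))) ->
  M \subset 'F(G).
Proof.
move=> nMG sTM pM; have [sMG nMG'] := andP nMG.
have nFG := Fitting_normal G.
rewrite -(Sylow_gen M) gen_subG; apply/bigcupsP=> S /SylowP[p p_pr sylS].
have sSM := pHall_sub sylS; have pS := pHall_pgroup sylS.
pose O := [group of 'O_p^'('F(G))].
have nOG : O <| G by rewrite !gFnormal_trans.
pose D := [group of M :&: 'C(O)].
have nDG : D <| G.
  rewrite /normal subIset ?sMG //= normsI // norms_cent // normal_norm //.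
apply: (@subset_trans _ _ D).
  rewrite subsetI sSM centsC -(Sylow_gen O) gen_subG.
  apply/bigcupsP=> X /SylowP[q q_pr sylX]; rewrite centsC.
  have qX := pHall_pgroup sylX.
  have [eqp|nqp] := eqVneq q p.
    suff -> : X :=: 1 by apply: cents1.
    apply/eqP; rewrite trivg_card1 (card_Hall sylX) partG_eq1 eqp.
    exact: pcore_pgroup.
  have sXO : X \subset 'O_q(G).
    rewrite -p_core_Fitting.
    rewrite (sub_Hall_pcore (nilpotent_pcore_Hall q (Fitting_nil G))) //.
    exact: subset_trans (pHall_sub sylX) (pcore_sub _ _).
  apply: subset_trans (centS sXO).
  suff : S \subset 'C_G('O_q(G)) by rewrite subsetI => /andP[].
  have nCS : S \subset 'N('C_G('O_q(G))).
    apply: subset_trans (subset_trans sSM sMG) _.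
    by rewrite normsI ?normG // norms_cent // gFnorm.
  rewrite -quotient_sub1 //.
  have qSC := pgroupS (quotientS 'C_G('O_q(G)) sSM) (pM q q_pr).
  have pSC := quotient_pgroup 'C_G('O_q(G)) pS.
  have : coprime #|S / 'C_G('O_q(G))| #|S / 'C_G('O_q(G))|.
    by apply: pnat_coprime pSC (pi_p'group qSC _); rewrite !inE eq_sym.
  by rewrite /coprime gcdnn -trivg_card1 => /eqP->.
have defF : 'O_p(G) * O = 'F(G).
  by have [_ e _ _] := dprodP (nilpotent_pcoreC p (Fitting_nil G)); rewrite -[RHS]e p_core_Fitting.
(* [Z] centralizes both factors of ['F(G)], hence lies in it, and [D / Z] is a p-group. *)
pose Z := [group of 'C_D('O_p(G))].
have sZD : Z \subset D by apply: subsetIl.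
have nZG : Z <| G.
  rewrite /normal (subset_trans sZD (normal_sub nDG)) //=.
  by apply: normsI; rewrite ?(normal_norm nDG) // norms_cent ?gFnorm.
have sZF : Z \subset 'F(G).
  apply: sub_Fitting_gen_Fitting => //.
    rewrite -defF centM subsetI subsetIr (subset_trans sZD) //.
    exact: subsetIr.
  apply: subset_trans sTM; apply: commgS; apply: subset_trans sZD _.
  exact: subsetIl.
have nilZ : nilpotent Z := nilpotentS sZF (Fitting_nil G).
(* [W] lies in [O], so it is central in [D]; its index in [D] is a power of p, so [D] is nilpotent
   modulo its centre. *)
pose W := [group of 'O_p^'(Z)].
have sWZ : W \subset Z by apply: pcore_sub.
have sWC : W \subset 'Z(D).
  rewrite subsetI (subset_trans sWZ) //=.
  have sWO : W \subset O.
    rewrite (sub_Hall_pcore (nilpotent_pcore_Hall _ (Fitting_nil G))) ?pcore_pgroup //.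
    exact: subset_trans sZF.
  by rewrite centsC; apply: subset_trans (subsetIr _ _) (centS sWO).
apply: (Fitting_max nDG); rewrite -quotient_center_nil.
apply: (@pgroup_nil _ p); rewrite /pgroup card_quotient ?normal_norm ?center_normal //.
apply: pnat_dvd (indexgS D sWC) _.
rewrite -(@Lagrange_index _ D Z W) // pnatM; apply/andP; split.
  have -> : Z :=: D :&: 'C_G('O_p(G)).
    by rewrite setIA (setIidPl (normal_sub nDG)).
  rewrite indexgI -card_quotient.
    by apply: pgroupS (pM p p_pr); apply: quotientS; apply: subsetIl.
  apply: subset_trans (normal_sub nDG) _.
  by rewrite normsI ?normG // norms_cent // gFnorm.
have [_ _] := and3P (nilpotent_pcore_Hall p^' nilZ).
by rewrite pnatNK.
Qed.

(** * From real probabilities to integers, and the bounds for G / F(G) *)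

Section RealBound.

Import Order.TTheory GRing.Theory Num.Theory.

Lemma PrStar_ge_cfrac (R : realType) (eps : R) : (0 < eps)%R ->
  exists2 N : nat, 0 < N & forall (gT : finGroupType) (X Y : {group gT}),
    PrStar_ge X Y eps -> forall p q : nat,
    p \in \pi(X) -> q \in \pi(Y) -> p != q ->
  exists P Q : {group gT}, [/\ p.-Sylow(X) P, q.-Sylow(Y) Q & cfrac N P Q].
Proof.
move=> eps0; pose N := (Num.bound (eps^-1)%R).+1; exists N => // gT X Y hXY p q pX qY npq.
have [P [Q [sylP sylQ hPQ]]] := hXY p q pX qY (elimN eqP npq).
exists P, Q; split; rewrite ?inE in sylP sylQ *; [by [] | by [] |].
rewrite /cfrac -card_commuting_pairs.
have PQ0 : (0 < #|P|%:R * #|Q|%:R :> R)%R.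
  by rewrite -natrM ltr0n muln_gt0 !cardG_gt0.
move: hPQ; rewrite /commuting_prob ler_pdivlMr // => hPQ.
rewrite -(ler_nat R) !natrM.
have Neps : (1 <= N%:R * eps :> R)%R.
  rewrite -ler_pdivrMr // div1r.
  apply: le_trans (ltW (archi_boundP _)) _.
    by rewrite invr_ge0 ltW.
  by rewrite ler_nat.
apply: le_trans (ler_wpM2l (ler0n _ _) hPQ).
by rewrite mulrA ler_peMl // ltW.
Qed.

End RealBound.

Section CommutingGenFitting.

Variables (N t f : nat) (gT : finGroupType) (G : {group gT}).
Local Notation T := (gen_Fitting G).

Hypothesis cfracG : forall p q : nat, p \in \pi(T) -> q \in \pi(G) -> p != q ->
  exists P Q : {group gT}, [/\ p.-Sylow(T) P, q.-Sylow(G) Q & cfrac N P Q].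

Lemma gen_Fitting_self_cfrac (p q : nat) :
  p \in \pi(T) -> q \in \pi(T) -> p != q ->
  exists P Q : {group gT}, [/\ p.-Sylow(T) P, q.-Sylow(T) Q & cfrac N P Q].
Proof.
move=> pT qT npq; have nTG := gen_Fitting_normal G.
have qG : q \in \pi(G) := piSg (normal_sub nTG) qT.
have [P [Q [sylP sylQ hPQ]]] := cfracG pT qG npq.
exists P, (T :&: Q)%G; split=> //; first exact: Sylow_setI_normal nTG sylQ.
exact: cfracS (subsetIr _ _) hPQ.
Qed.

Hypothesis fP : forall (p q : nat) (V Q : {group gT}),
  p.-group V -> q.-group Q -> p != q -> Q \subset 'N(V) -> cfrac N Q V ->
  #|Q : 'C(V)| <= f.

(** For q other than p, a Sylow q-subgroup of [G] commutes often with a Sylow p-subgroup of [T],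
    hence with its subgroup ['O_p(G)], and coprime action applies. *)
Lemma pcore_action_p'_part (p : nat) : #|G : 'C_G('O_p(G))|`_p^' <= f.+1 ^ f.+2.
Proof.
have sVF : 'O_p(G) \subset 'F(G) by rewrite -p_core_Fitting pcore_sub.
set V := 'O_p(G)%G in sVF *.
apply: leq_partn_bound => // q q_pr.
have [->|nqp] := eqVneq q p.
  by rewrite (part_p'nat (part_pnat _ _)).
rewrite partn_part; last by move=> r; rewrite !inE => /eqnP->.
have [Q sylQ] := Sylow_exists q G.
apply: leq_trans (leq_part_index (subsetIl _ _) sylQ) _.
have sQG := pHall_sub sylQ.
rewrite -indexgI /= setIA (setIidPl sQG) indexgI.
have [cQV|ncQV] := boolP (Q \subset 'C(V)).
  by move: cQV; rewrite -indexg_eq1 => /eqP->.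
apply: leqW; have pV : p.-group V := pcore_pgroup p G.
have sVT : V \subset T.
  exact: subset_trans sVF (Fitting_sub_gen_Fitting G).
have ntV : V :!=: 1 by apply: contraNneq ncQV => ->; apply: cents1.
have ntQ : Q :!=: 1 by apply: contraNneq ncQV => ->; apply: sub1G.
have pT : p \in \pi(T).
  apply: (piSg sVT); have [p_pr pdvd _] := pgroup_pdiv pV ntV.
  by rewrite mem_primes p_pr cardG_gt0.
have qG : q \in \pi(G).
  apply: (piSg sQG); have [_ qdvd _] := pgroup_pdiv (pHall_pgroup sylQ) ntQ.
  by rewrite mem_primes q_pr cardG_gt0.
rewrite eq_sym in nqp; have [P [Q' [sylP sylQ' hPQ]]] := cfracG pT qG nqp.
have nVG : G \subset 'N(V) by apply: gFnorm.
have [x xG defQ] := Sylow_trans sylQ' sylQ.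
have sVP : V \subset P.
  apply: subset_trans (pcore_sub_Hall sylP).
  by rewrite pcore_max // /normal sVT (subset_trans (normal_sub (gen_Fitting_normal G))).
have hQV : cfrac N Q' V := cfracS sVP (cfracC hPQ).
have := fP pV (pHall_pgroup sylQ') nqp (subset_trans (pHall_sub sylQ') nVG) hQV.
have eC : 'C(V) :^ x = 'C(V) by rewrite -centJ (normsP nVG x xG).
suff <- : #|Q' : 'C(V)| = #|Q : 'C(V)| by [].
by rewrite defQ -{2}eC indexJg.
Qed.

Hypothesis tP : #|T : 'F(T)| <= t.

(** [M] is the preimage of the centralizer of [T / 'F(G)] in [G / 'F(G)]; [T / 'F(G)] has order at
    most [t] because ['F(T)] lies in ['F(G)]. *)
Lemma gen_Fitting_action_subgroup :
  exists M : {group gT}, [/\ M <| G, #|G : M| <= t`! & [~: T, M] \subset 'F(G)].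
Proof.
have nTG := gen_Fitting_normal G; have nFG := Fitting_normal G.
have sFTF : 'F(T) \subset 'F(G).
  by rewrite Fitting_max ?Fitting_nil // gFnormal_trans.
have leTF : #|T / 'F(G)| <= t.
  rewrite card_quotient; last exact: subset_trans (normal_sub nTG) (normal_norm nFG).
  exact: leq_trans (leq_indexgS _ sFTF) tP.
pose M := [group of G :&: coset 'F(G) @*^-1 'C(T / 'F(G))].
have nTQ : G / 'F(G) \subset 'N(T / 'F(G)) by rewrite quotient_norms ?normal_norm.
have defM : M :=: coset 'F(G) @*^-1 'C_(G / 'F(G))(T / 'F(G)).
  by rewrite /= morphpreI quotientGK.
exists M; split.
- have nM : 'C_(G / 'F(G))(T / 'F(G)) <| G / 'F(G).
    by rewrite /normal subsetIl normsI ?normG // norms_cent.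
  by move: nM; rewrite -cosetpre_normal quotientGK // -defM.
- apply: leq_trans (leq_fact leTF); apply: leq_trans (index_cent_leq nTQ).
  by rewrite -index_cosetpre quotientGK // -defM.
rewrite commGC -quotient_cents2.
- by apply: subset_trans (quotientS _ (subsetIr _ _)) _; rewrite cosetpreK.
- exact: subset_trans (subsetIl _ _) (normal_norm nFG).
- exact: subset_trans (normal_sub nTG) (normal_norm nFG).
Qed.

Let h := ((f.+1 ^ f.+2)`!)%N.

Lemma pcore_action_subgroup (p : nat) : exists R : {group gT},
  [/\ R <| G, #|G : R| <= h & p.-group (R / 'C_G('O_p(G)))].
Proof.
apply: big_pgroup_quotient (pcore_action_p'_part p).
by rewrite /normal subsetIl normsI ?normG // norms_cent // gFnorm.
Qed.

(** Each prime dividing [#|'F(G)|] contributes one subgroup [R] and a factor [h] to the index, but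
    the same power [h!] sends [G] into every [R], so the exponent does not grow. *)
Lemma Fitting_large_subgroup : exists M : {group gT}, [/\ M \subset 'F(G),
    #|G : M| <= t`! * h ^ size (primes #|'F(G)|)
  & {in G, forall x, x ^+ (t`!`! * h`!) \in M}].
Proof.
have [M0 [nM0 iM0 sM0]] := gen_Fitting_action_subgroup.
have main (ps : seq nat) : exists M : {group gT}, [/\ M <| G, M \subset M0,
    #|G : M| <= t`! * h ^ size ps, {in G, forall x, x ^+ (t`!`! * h`!) \in M}
  & {in ps, forall p : nat, p.-group (M / 'C_G('O_p(G)))}].
  elim: ps => [|p ps [M [nM sM iM xM pM]]].
    exists M0; rewrite muln1; split=> // x xG.
    by rewrite expgM groupX // (mem_expg_fact nM0).
  have [R [nR iR pR]] := pcore_action_subgroup p.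
  exists (M :&: R)%G; split.
  - exact: normalI.
  - by rewrite subIset ?sM.
  - by apply: leq_trans (leq_indexI _ _ _) _; rewrite expnSr mulnA leq_mul.
  - by move=> x xG; rewrite inE xM //= mulnC expgM groupX // (mem_expg_fact nR).
  move=> q; rewrite inE => /predU1P[->|qps].
    by apply: pgroupS pR; rewrite quotientS ?subsetIr.
  by apply: pgroupS (pM q qps); rewrite quotientS ?subsetIl.
have [M [nM sM iM xM pM]] := main (primes #|'F(G)|); exists M; split=> //.
apply: sub_Fitting_pgroup_action => // [|p p_pr].
  exact: subset_trans (commgS _ sM) sM0.
have [pF|] := boolP (p \in primes #|'F(G)|); first exact: pM.
move=> npF; have -> : 'O_p(G) = 1.
  rewrite -p_core_Fitting; apply/eqP; apply: contraR npF => ntO.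
  have [_ pdvd _] := pgroup_pdiv (pcore_pgroup p 'F(G)) ntO.
  rewrite mem_primes p_pr cardG_gt0; apply: dvdn_trans pdvd (cardSg (pcore_sub _ _)).
rewrite cent1T setIT; have -> : M / G = 1.
  by apply/trivgP; rewrite quotient_sub1 (subset_trans (normal_sub nM)) ?normG.
exact: pgroup1.
Qed.

End CommutingGenFitting.

Local Close Scope group_scope.
Unset Implicit Arguments.

Theorem theorem1p4 (R : realType) (eps : R) (eps_gt0 : (0 < eps)%R) :
  (exists e : nat, forall (gT : finGroupType) (G : {group gT}),
     PrStar_ge (gen_Fitting G) G eps ->
     exponent (G / 'F(G))%g <= e)
  /\
  (forall s : nat, exists n : nat, forall (gT : finGroupType) (G : {group gT}),
     PrStar_ge (gen_Fitting G) G eps ->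
     size (primes #|'F(G)%g|) = s ->
     #|G : 'F(G)|%g <= n).
Proof.
(* [N], [t] and [f] are fixed from [eps] before any group is given. *)
have [N N0 hN] := PrStar_ge_cfrac eps_gt0.
have [t ht] := index_Fitting_leq N0.
have [f hf] := index_cent_coprime_cfrac N0.
pose h := ((f.+1 ^ f.+2)`!)%N.
have main (gT : finGroupType) (G : {group gT}) : PrStar_ge (gen_Fitting G) G eps ->
    exists M : {group gT}, [/\ M \subset 'F(G)%g,
      #|G : M|%g <= t`! * h ^ size (primes #|'F(G)%g|)
      & {in G, forall x, (x ^+ (t`!`! * h`!))%g \in M}].
  move=> hG; have cG := hN gT _ _ hG.
  apply: (Fitting_large_subgroup cG (hf gT)).
  apply: ht; first exact: gen_Fitting_self_cfrac cG.
  by move=> p q P; apply: Sylow_gen_Fitting_cent.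
split.
  exists (t`!`! * h`!) => gT G /main[M [sMF _ xM]].
  apply: dvdn_leq; first by rewrite muln_gt0 !fact_gt0.
  apply/exponentP=> _ /morphimP[x nFx xG ->].
  rewrite -morphX //; apply: coset_id.
  exact: (subsetP sMF _ (xM x xG)).
move=> s; exists (t`! * h ^ s) => gT G /main[M [sMF iM _]] <-.
exact: leq_trans (leq_indexgS G sMF) iM.
Qed.
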